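(* Let $(\mathcal M,\mathbb E,B)$ be a $C^*$-operator-valued non-commutative probability space and let $x=x^*,y=y^*\in\mathcal M$ be two selfadjoint random variables which are free over $B$. Then there exists a unique pair of Fréchet (and thus also Gâteaux) analytic maps $\omega_1,\omega_2\colon\mathbb H^+(B)\to\mathbb H^+(B)$ such that (1) $\Im\omega_j(b)\ge\Im b$ for all $b\in\mathbb H^+(B)$ and $j\in\{1,2\}$; (2) $F_x(\omega_1(b))+b=F_y(\omega_2(b))+b=\omega_1(b)+\omega_2(b)$ for all $b\in\mathbb H^+(B)$; (3) $G_x(\omega_1(b))=G_y(\omega_2(b))=G_{x+y}(b)$ for all $b\in\mathbb H^+(B)$. Moreover, for every $b\in\mathbb H^+(B)$, $\omega_1(b)$ is the unique fixed point of the map $$f_b\colon\mathbb H^+(B)\to\mathbb H^+(B),\qquad f_b(w)=h_y(h_x(w)+b)+b,$$ and $\omega_1(b)=\lim_{n\to\infty}f_b^{\circ n}(w)$ (in norm) for any $w\in\mathbb H^+(B)$, where $f_b^{\circ n}$ denotes the $n$-fold composition of $f_b$ with itself. Likewise, for every $b\in\mathbb H^+(B)$, $\omega_2(b)$ is the unique fixed point in $\mathbb H^+(B)$ of the map $g_b\colon\mathbb H^+(B)\to\mathbb H^+(B)$, $g_b(w)=h_x(h_y(w)+b)+b$, and $\omega_2(b)=\lim_{n\to\infty}g_b^{\circ n}(w)$ for any $w\in\mathbb H^+(B)$.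
   Context: A $C^*$-operator-valued non-commutative probability space $(\mathcal M,\mathbb E,B)$ consists of a unital $C^*$-algebra $\mathcal M$, a $C^*$-subalgebra $B\subseteq\mathcal M$ containing the unit $\mathbf 1$ of $\mathcal M$, and a unit-preserving, completely positive conditional expectation $\mathbb E\colon\mathcal M\to B$ (so $\mathbb E$ is linear, $\mathbb E[b]=b$ and $\mathbb E[b_1 a b_2]=b_1\mathbb E[a]b_2$ for $b,b_1,b_2\in B$, $a\in\mathcal M$). No trace is assumed. Freeness: two algebras $A_1,A_2\subseteq\mathcal M$ containing $B$ are free over $B$ (with respect to $\mathbb E$) if $\mathbb E[x_1x_2\cdots x_n]=0$ whenever $n\in\mathbb N$, $x_j\in A_{i_j}$ satisfy $\mathbb E[x_j]=0$ for all $j$, and $i_j\ne i_{j+1}$ for $1\le j\le n-1$. Elements $x,y\in\mathcal M$ are free over $B$ if $B\langle x\rangle$ and $B\langle y\rangle$ are, where $B\langle x\rangle$ is the algebra generated by $B$ and $x$. For $a\in\mathcal M$, $\Re a=\frac{a+a^*}{2}$ and $\Im a=\frac{a-a^*}{2i}$. The notation $a>0$ means $a\ge0$ and $a$ is invertible (equivalently $a\ge\varepsilon\mathbf 1$ for some real $\varepsilon>0$). The operator upper half-plane is $\mathbb H^+(B)=\{b\in B:\Im b>0\}$. For $x=x^*\in\mathcal M$ and $b\in\mathbb H^+(B)$ define $G_x(b)=\mathbb E[(b-x)^{-1}]$, $F_x(b)=G_x(b)^{-1}=\mathbb E[(b-x)^{-1}]^{-1}$ and $h_x(b)=F_x(b)-b$.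 These are well defined on $\mathbb H^+(B)$, and it is known that $\Im F_x(b)\ge\Im b$, i.e. $\Im h_x(b)\ge0$, for $b\in\mathbb H^+(B)$. *)

(* Defs.v *)
From HB Require Import structures.
From mathcomp Require Import all_boot all_order all_algebra complex.
From mathcomp Require Import all_classical all_reals all_analysis.

Set Implicit Arguments.
Unset Strict Implicit.
Unset Printing Implicit Defensive.

Import Order.TTheory GRing.Theory Num.Theory numFieldNormedType.Exports.

Local Open Scope classical_set_scope.
Local Open Scope ring_scope.

(* The hierarchy has no common refinement of unitAlgType and normedModType
   (the join of their ring and normed-module parts is already taken by
   numDomainType), so both structures are put on the type [carrier A] of a
   bundled algebra A.  Norms take values in the field of scalars R[i], as in
   normedModType; the axioms force them to be nonnegative reals. *)
Record normed_alg (R : realType) := NormedAlg {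
  ring_part : unitAlgType R[i];
  normf : ring_part -> R[i];
  normf_triangle : forall a b, normf (a + b) <= normf a + normf b;
  normf_scale : forall (z : R[i]) a, normf (z *: a) = `|z| * normf a;
  normf_eq0 : forall a, normf a = 0 -> a = 0;
  normf_mul : forall a b, normf (a * b) <= normf a * normf b
}.

Definition carrier (R : realType) (A : normed_alg R) : Type := ring_part A.

HB.instance Definition _ (R : realType) (A : normed_alg R) :=
  GRing.UnitAlgebra.copy (carrier A) (ring_part A).

HB.instance Definition _ (R : realType) (A : normed_alg R) :=
  Lmodule_isNormed.Build R[i] (carrier A)
    (@normf_triangle R A) (@normf_scale R A) (@normf_eq0 R A).

Coercion carrier : normed_alg >-> Sortclass.

(* Unital C*-algebra over the complex numbers R[i]. *)
Record cstar_alg (R : realType) := CStarAlg {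
  cstar_normed :> normed_alg R;
  star : cstar_normed -> cstar_normed;
  cstar_complete : forall F : set_system cstar_normed,
    ProperFilter F -> cauchy F -> cvg F;
  starK : involutive star;
  starD : {morph star : a b / a + b};
  starZ : forall (z : R[i]) a, star (z *: a) = z^* *: star a;
  starM : forall a b, star (a * b) = star b * star a;
  cstar_identity : forall a, `|star a * a| = `|a| ^+ 2
}.

Section CStarTheory.
Context {R : realType} {A : cstar_alg R}.

Definition selfadjoint (a : A) : Prop := star a = a.

Definition cIm (a : A) : A := (2 * 'i)^-1 *: (a - star a).

Definition nonneg (a : A) : Prop := exists c : A, a = star c * c.

Definition strictly_pos (a : A) : Prop := nonneg a /\ a \is a GRing.unit.

Definition mxstar n (C : 'M[A]_n) : 'M[A]_n := (map_mx (@star R A) C)^T.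

(* Positivity in the C*-algebra of n x n matrices over A. *)
Definition mxnonneg n (P : 'M[A]_n) : Prop :=
  exists C : 'M[A]_n, P = mxstar C *m C.

End CStarTheory.

Definition upper_half_plane (R : realType) (B : cstar_alg R) : set B :=
  [set b | strictly_pos (cIm b)].

(* The C*-subalgebra B of M is given by its inclusion [incl], a unital
   isometric *-homomorphism; its range is then closed, B being complete. *)
Record opv_prob_space (R : realType) (M B : cstar_alg R)
    (incl : {lrmorphism B -> M}) (E : {linear M -> B}) : Prop := {
  incl_star : forall b : B, incl (star b) = star (incl b);
  incl_isometry : forall b : B, `|incl b| = `|b|;
  condexp_unit : E 1 = 1;
  condexp_id : forall b : B, E (incl b) = b;
  condexp_bimodule : forall (b1 b2 : B) (a : M),
    E (incl b1 * a * incl b2) = b1 * E a * b2;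
  condexp_cp : forall n (P : 'M[M]_n), mxnonneg P -> mxnonneg (map_mx E P)
}.

Section Freeness.
Context {R : realType} {M B : cstar_alg R}.
Variables (incl : {lrmorphism B -> M}) (E : {linear M -> B}).

(* The algebra B<x>: no closure is taken. *)
Definition generated_alg (x : M) : set M :=
  smallest [set S : set M | GRing.subalg_closed [in S]]
    (range incl `|` [set x]).

(* The factors of a word are numbered from 0 to n - 1; the empty word, whose
   expectation is 1, is excluded. *)
Definition free_algs (A1 A2 : set M) : Prop :=
  forall (n : nat) (i : nat -> bool) (x : nat -> M),
    (0 < n)%N ->
    (forall j, (j < n)%N -> (if i j then A1 else A2) (x j) /\ E (x j) = 0) ->
    (forall j, (j.+1 < n)%N -> i j != i j.+1) ->
    E (\prod_(0 <= j < n) x j) = 0.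

Definition free_over (x y : M) : Prop :=
  free_algs (generated_alg x) (generated_alg y).

End Freeness.

Section Transforms.
Context {R : realType} {M B : cstar_alg R}.
Variables (incl : {lrmorphism B -> M}) (E : {linear M -> B}).

Definition Gtr (x : M) (b : B) : B := E ((incl b - x)^-1).

Definition Ftr (x : M) (b : B) : B := (Gtr x b)^-1.

Definition htr (x : M) (b : B) : B := Ftr x b - b.

Definition fixmap (x y : M) (b w : B) : B := htr y (htr x w + b) + b.

End Transforms.

(* [w] is only considered on the upper half-plane, which is open in B, so
   that complex Frechet differentiability at its points does not depend on the
   values of [w] elsewhere. *)
Definition frechet_analytic_selfmap (R : realType) (B : cstar_alg R)
    (w : B -> B) : Prop :=
  (forall b, upper_half_plane b -> upper_half_plane (w b)) /\
  (forall b, upper_half_plane b -> differentiable w b).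

Record subordination_pair (R : realType) (M B : cstar_alg R)
    (incl : {lrmorphism B -> M}) (E : {linear M -> B}) (x y : M)
    (w1 w2 : B -> B) : Prop := {
  sub_analytic1 : frechet_analytic_selfmap w1;
  sub_analytic2 : frechet_analytic_selfmap w2;
  sub_Im : forall b, upper_half_plane b ->
    nonneg (cIm (w1 b) - cIm b) /\ nonneg (cIm (w2 b) - cIm b);
  sub_F : forall b, upper_half_plane b ->
    Ftr incl E x (w1 b) + b = Ftr incl E y (w2 b) + b /\
    Ftr incl E y (w2 b) + b = w1 b + w2 b;
  sub_G : forall b, upper_half_plane b ->
    Gtr incl E x (w1 b) = Gtr incl E y (w2 b) /\
    Gtr incl E y (w2 b) = Gtr incl E (x + y) b
}.

(* [c] is the unique fixed point in the upper half-plane of its selfmap [f],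
   and it attracts every orbit in norm. *)
Definition attracting_unique_fixpoint (R : realType) (B : cstar_alg R)
    (f : B -> B) (c : B) : Prop :=
  [/\ forall w, upper_half_plane w -> upper_half_plane (f w),
      upper_half_plane c /\ f c = c,
      forall w, upper_half_plane w -> f w = w -> w = c
    & forall w, upper_half_plane w -> (fun n => iter n f w) @ \oo --> c].

(* Main.v *)
(* The paper's proof rests on the Earle-Hamilton theorem and on analytic
   continuation; here both are replaced by explicit identities.

   Let r = (w - x)^-1, F = F_x(w), a = F r - 1 and a' = r F - 1, so that
   E[a] = E[a'] = 0.  Then
     Im h_x(w) = E[a (Im w) a^*] = E[a'^* (Im w) a'],
     h_x(w) - h_x(v) = E[a_w (w - v) a'_v],
   and the Cauchy-Schwarz inequality for E shows that w |-> h_x(w) + b contracts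
   || (Im w)^(-1/2) (w - v) (Im v)^(-1/2) ||, strictly because h_x is bounded
   on {Im w >= e}.  This gives the fixed points, and, applied to the linearized
   equation, their differentiability in b.

   For G_{x+y}, put F = F_x(w1) = F_y(w2) = w1 + w2 - b and
   a_i = F r_i - 1; then F r1 (b - x - y) r2 = 1 - a1 a2.  Expanding
   (1 - a1 a2)^-1 as a finite geometric sum plus a remainder, freeness kills all
   terms but one.  The remainder is controlled by iterating the maps
   eta_i(c) = E[a_i c a_i^*], for which eta2(Im w2) = Im w1 - Im b and
   eta1(Im w1) = Im w2 - Im b. *)
Require Import Defs.
From HB Require Import structures.
From mathcomp Require Import all_boot all_order all_algebra complex.
From mathcomp Require Import all_classical all_reals all_analysis.
From mathcomp Require Import ring lra.

Set Implicit Arguments.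
Unset Strict Implicit.
Unset Printing Implicit Defensive.

Import Order.TTheory GRing.Theory Num.Theory numFieldNormedType.Exports.
Local Open Scope classical_set_scope.
Local Open Scope ring_scope.

(** * Normalization of noncommutative polynomial identities *)

Section NCRing.
Variables (K : comNzRingType) (A : algType K).

(** The axioms offer only the C*-identity and completeness, and elements of the form [star c * c]
    are not visibly closed under sums. The order therefore rests on [pos], a cone by construction,
    which Kelley-Vaught identifies with [nonneg]. Square roots come from an iteration; facts proved
    for [spos] reach [pos] by perturbation.

    The contracted quantity compares with the norm only where Im is bounded below and the norm
    above. Both hold after one step of the fixed-point map, which is why the estimates concern
    iterates from the first on.

    Nothing makes a1 a2 small in norm. What decays is E[p star p] for p = (a1 a2)^n, and Schwarz
    lets this absorb any fixed right factor, such as (1 - a1 a2)^-1, whose existence comes from that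
    of (b - x - y)^-1. Freeness concerns unclosed algebras while resolvents lie in closures, so
    words are first approximated by centred words. *)

Inductive ncexpr :=
  | NCvar of nat | NC0 | NC1
  | NCadd of ncexpr & ncexpr | NCopp of ncexpr | NCmul of ncexpr & ncexpr
  | NCscale of K & ncexpr.

Variable env : seq A.

Fixpoint nc_eval (e : ncexpr) : A :=
  match e with
  | NCvar n => nth 0 env n
  | NC0 => 0
  | NC1 => 1
  | NCadd e1 e2 => nc_eval e1 + nc_eval e2
  | NCopp e1 => - nc_eval e1
  | NCmul e1 e2 => nc_eval e1 * nc_eval e2
  | NCscale c e1 => c *: nc_eval e1
  end.

Definition nc_mon (m : seq nat) : A := foldr (fun n a => nth 0 env n * a) 1 m.

Definition nc_lin (l : seq (K * seq nat)) : A :=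
  foldr (fun p a => p.1 *: nc_mon p.2 + a) 0 l.

Fixpoint nc_insert (c : K) (m : seq nat) (l : seq (K * seq nat)) :=
  match l with
  | [::] => [:: (c, m)]
  | p :: l' =>
    if (m == p.2 :> seq nat) then (c + p.1, m) :: l'
    else p :: nc_insert c m l'
  end.

Fixpoint nc_add (l1 l2 : seq (K * seq nat)) :=
  match l1 with
  | [::] => l2
  | p :: l => nc_insert p.1 p.2 (nc_add l l2)
  end.

Fixpoint nc_term (c : K) (m : seq nat) (l : seq (K * seq nat)) :=
  match l with
  | [::] => [::]
  | p :: l' => nc_insert (c * p.1) (m ++ p.2) (nc_term c m l')
  end.

Fixpoint nc_mul (l1 l2 : seq (K * seq nat)) :=
  match l1 with
  | [::] => [::]
  | p :: l => nc_add (nc_term p.1 p.2 l2) (nc_mul l l2)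
  end.

Fixpoint nc_norm (e : ncexpr) : seq (K * seq nat) :=
  match e with
  | NCvar n => [:: (1, [:: n])]
  | NC0 => [::]
  | NC1 => [:: (1, [::])]
  | NCadd e1 e2 => nc_add (nc_norm e1) (nc_norm e2)
  | NCopp e1 => nc_term (- 1) [::] (nc_norm e1)
  | NCmul e1 e2 => nc_mul (nc_norm e1) (nc_norm e2)
  | NCscale c e1 => nc_term c [::] (nc_norm e1)
  end.

Lemma nc_insertE c m l : nc_lin (nc_insert c m l) = c *: nc_mon m + nc_lin l.
Proof.
elim: l => //= p l IH; case: eqP => [->|_] /=.
  by rewrite scalerDl addrA.
by rewrite IH addrCA.
Qed.

Lemma nc_addE l1 l2 : nc_lin (nc_add l1 l2) = nc_lin l1 + nc_lin l2.
Proof. by elim: l1 => [|p l IH] /=; rewrite ?add0r // nc_insertE IH addrA. Qed.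

Lemma nc_mon_cat m1 m2 : nc_mon (m1 ++ m2) = nc_mon m1 * nc_mon m2.
Proof. by elim: m1 => [|n m IH] /=; rewrite ?mul1r // IH mulrA. Qed.

Lemma nc_termE c m l : nc_lin (nc_term c m l) = c *: (nc_mon m * nc_lin l).
Proof.
elim: l => [|p l IH] /=; first by rewrite mulr0 scaler0.
by rewrite nc_insertE IH mulrDr scalerDr -scalerAr scalerA nc_mon_cat.
Qed.

Lemma nc_mulE l1 l2 : nc_lin (nc_mul l1 l2) = nc_lin l1 * nc_lin l2.
Proof.
elim: l1 => [|p l IH] /=; first by rewrite mul0r.
by rewrite nc_addE nc_termE IH mulrDl scalerAl.
Qed.

Lemma nc_normE e : nc_lin (nc_norm e) = nc_eval e.
Proof.
elim: e => /= [n|||e1 <- e2 <-|e <-|e1 <- e2 <-|c e <-] //.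
- by rewrite mulr1 scale1r addr0.
- by rewrite scale1r addr0.
- by rewrite nc_addE.
- by rewrite nc_termE /= mul1r scaleN1r.
- by rewrite nc_mulE.
- by rewrite nc_termE /= mul1r.
Qed.

Fixpoint nc_zero (l : seq (K * seq nat)) : Prop :=
  match l with
  | [::] => True
  | p :: l' => p.1 = 0 /\ nc_zero l'
  end.

(** Coefficients stay symbolic, so their vanishing is not a computation: [nc_zero] leaves one scalar
    equation per monomial to [ring] or [field]. *)
Lemma nc_ringP e1 e2 :
  nc_zero (nc_norm (NCadd e1 (NCopp e2))) -> nc_eval e1 = nc_eval e2.
Proof.
move=> h; apply/eqP; rewrite -subr_eq0; apply/eqP.
rewrite -[LHS]/(nc_eval (NCadd e1 (NCopp e2))) -nc_normE.
by elim: (nc_norm _) h => //= p l IH [-> /IH ->]; rewrite scale0r addr0.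
Qed.

End NCRing.

(* Atoms are compared up to conversion: rewriting with [rmorphD] or [linearD]
   leaves different coercion paths in front of the same morphism. *)
Ltac nc_mem a l :=
  match l with
  | nil => constr:(false)
  | ?b :: _ => let _ := match goal with _ => unify a b end in constr:(true)
  | _ :: ?l' => nc_mem a l'
  end.

Ltac nc_index a l :=
  match l with
  | ?b :: _ => let _ := match goal with _ => unify a b end in constr:(0%N)
  | _ :: ?l' => let n := nc_index a l' in constr:(S n)
  end.

Ltac nc_atoms t l :=
  lazymatch t with
  | GRing.add ?a ?b => let l1 := nc_atoms a l in nc_atoms b l1
  | GRing.mul ?a ?b => let l1 := nc_atoms a l in nc_atoms b l1
  | GRing.opp ?a => nc_atoms a l
  | GRing.scale _ ?a => nc_atoms a l
  | GRing.zero => l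
  | GRing.one _ => l
  | _ => let b := nc_mem t l in
         lazymatch b with true => l | false => constr:(t :: l) end
  end.

Ltac nc_reify K t l :=
  lazymatch t with
  | GRing.add ?a ?b =>
    let e1 := nc_reify K a l in let e2 := nc_reify K b l in
    constr:(@NCadd K e1 e2)
  | GRing.mul ?a ?b =>
    let e1 := nc_reify K a l in let e2 := nc_reify K b l in
    constr:(@NCmul K e1 e2)
  | GRing.opp ?a => let e1 := nc_reify K a l in constr:(@NCopp K e1)
  | GRing.scale ?c ?a => let e1 := nc_reify K a l in constr:(@NCscale K c e1)
  | GRing.zero => constr:(@NC0 K)
  | GRing.one _ => constr:(@NC1 K)
  | _ => let n := nc_index t l in constr:(@NCvar K n)
  end.

Ltac nc_ring_with K :=
  lazymatch goal with
  | |- @eq ?T ?a ?b =>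
    let l0 := constr:(@nil T) in
    let l1 := nc_atoms a l0 in
    let l := nc_atoms b l1 in
    let e1 := nc_reify K a l in
    let e2 := nc_reify K b l in
    change (nc_eval l e1 = nc_eval l e2);
    apply: nc_ringP;
    cbn [nc_zero nc_norm nc_add nc_mul nc_term nc_insert cat fst snd
         eq_op Equality.sort];
    rewrite /=;
    repeat (split; [first [ring | by field]|]); try exact: I
  end.

Ltac nc_ring :=
  lazymatch goal with
  | R : realType |- _ => nc_ring_with (R[i] : comNzRingType)
  end.

Notation "r *:c a" := (r%:C%C *: a) (at level 40, a at level 40) : ring_scope.

(** * Norm and involution *)

Section Norm.
Context {R : realType} {A : cstar_alg R}.
Implicit Types (a b c : A) (r s t : R).

(** The norm of the hierarchy has values in [R[i]]; its real part carries the same information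
    ([nrmE]) and lives in an ordered field where [lra] applies. *)
Definition nrm a : R := complex.Re `|a|.

Lemma nrmE a : `|a| = (nrm a)%:C%C.
Proof. by rewrite /nrm RRe_real // ger0_real. Qed.

Lemma nrm_ge0 a : 0 <= nrm a.
Proof. by rewrite -ler0c -nrmE. Qed.

Lemma nrm0 : nrm 0 = 0.
Proof. by rewrite /nrm normr0. Qed.

Lemma nrm_eq0 a : nrm a = 0 -> a = 0.
Proof. by move=> h; apply/eqP; rewrite -normr_eq0 nrmE h. Qed.

Lemma nrmD a b : nrm (a + b) <= nrm a + nrm b.
Proof. by rewrite -lecR rmorphD /= -!nrmE ler_normD. Qed.

Lemma nrmN a : nrm (- a) = nrm a.
Proof. by rewrite /nrm normrN. Qed.

Lemma nrmB a b : nrm (a - b) <= nrm a + nrm b.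
Proof. by rewrite -(nrmN b) nrmD. Qed.

Lemma nrm_distC a b : nrm (a - b) = nrm (b - a).
Proof. by rewrite -nrmN opprB. Qed.

Lemma nrm_dist a b c : nrm (a - c) <= nrm (a - b) + nrm (b - c).
Proof. by rewrite -{1}(subrK b a) -addrA nrmD. Qed.

Lemma nrmM a b : nrm (a * b) <= nrm a * nrm b.
Proof. by rewrite -lecR rmorphM /= -!nrmE; apply: normf_mul. Qed.

Lemma nrmZ (z : R[i]) a : nrm (z *: a) = complex.Re `|z| * nrm a.
Proof.
apply: complexI; rewrite rmorphM -!nrmE normrZ; congr (_ * _).
by rewrite [RHS]RRe_real // ger0_real.
Qed.

Lemma nrmZr r a : nrm (r *:c a) = `|r| * nrm a.
Proof.
by rewrite nrmZ normc_def /= expr0n /= addr0 sqrtr_sqr.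
Qed.

Lemma nrmZi a : nrm ('i *: a) = nrm a.
Proof. by rewrite nrmZ normCi mul1r. Qed.

Lemma star0 : star (0 : A) = 0.
Proof. by apply: (addrI (star 0)); rewrite -starD !addr0. Qed.

Lemma starN a : star (- a) = - star a.
Proof. by apply: (addrI (star a)); rewrite -starD !subrr star0. Qed.

Lemma starB a b : star (a - b) = star a - star b.
Proof. by rewrite starD starN. Qed.

Lemma star1 : star (1 : A) = 1.
Proof. by rewrite -[LHS]mulr1 -{2}(starK 1) -starM mulr1 starK. Qed.

Lemma starZr r a : star (r *:c a) = r *:c star a.
Proof. by rewrite starZ conj_Creal //; apply/complex_realP; exists r. Qed.

Lemma starZi a : star ('i *: a) = - 'i *: star a.
Proof. by rewrite starZ conjCi. Qed.

Lemma starV a : a \is a GRing.unit -> star a \is a GRing.unit.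
Proof.
move=> ua; apply/unitrP; exists (star a^-1).
by rewrite -!starM mulrV // mulVr // star1.
Qed.

Lemma star_inv a : a \is a GRing.unit -> star a^-1 = (star a)^-1.
Proof.
move=> ua; apply: (mulrI (starV ua)).
by rewrite mulrV ?starV // -starM mulVr // star1.
Qed.

Lemma nrm_cstar a : nrm (star a * a) = nrm a ^+ 2.
Proof. by apply: complexI; rewrite rmorphXn /= -!nrmE cstar_identity. Qed.

Lemma nrm_star a : nrm (star a) = nrm a.
Proof.
suff h b : nrm b <= nrm (star b).
  by apply/eqP; rewrite eq_le h -{2}(starK a) h.
have [->|b0] := eqVneq (nrm b) 0; first exact: nrm_ge0.
have bp : 0 < nrm b by rewrite lt_def b0 nrm_ge0.
by rewrite -(ler_pM2r bp) -expr2 -nrm_cstar nrmM.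
Qed.

Lemma nrm1 : nrm (1 : A) = 1.
Proof.
have n0 : nrm (1 : A) != 0.
  by apply/eqP => /nrm_eq0/eqP; rewrite oner_eq0.
by apply: (mulfI n0); rewrite mulr1 -expr2 -nrm_cstar star1 mul1r.
Qed.

Lemma nrm_rs r : nrm (r *:c (1 : A)) = `|r|.
Proof. by rewrite nrmZr nrm1 mulr1. Qed.

Lemma nrmX a n : nrm (a ^+ n) <= nrm a ^+ n.
Proof.
elim: n => [|n IH]; first by rewrite !expr0 nrm1.
rewrite !exprS; apply: le_trans (nrmM _ _) _.
by rewrite ler_wpM2l // nrm_ge0.
Qed.

Lemma geom_lt (C q e : R) : 0 <= q -> q < 1 -> 0 < e ->
  exists N, forall n, (N <= n)%N -> C * q ^+ n < e.
Proof.
move=> q0 q1 e0.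
have h : C * q ^+ n @[n --> \oo] --> (0 : R).
  rewrite -[X in _ --> X](mulr0 C); apply: cvgM; first exact: cvg_cst.
  by apply: cvg_expr; rewrite ger0_norm.
have /cvgrPdist_lt/(_ _ e0)[N _ hN] := h.
exists N => n Nn; have := hN n Nn.
by rewrite /= sub0r normrN; apply: le_lt_trans (ler_norm _).
Qed.

(** Turns an identity between limits into an estimate at each stage n, without appeal to continuity
    of the operations. *)
Lemma nrm_small a (C q : R) : 0 <= q -> q < 1 ->
  (forall n, nrm a <= C * q ^+ n) -> a = 0.
Proof.
move=> q0 q1 h; apply: nrm_eq0; apply/eqP; rewrite eq_le nrm_ge0 andbT.
rewrite leNgt; apply/negP => a0.
have [N hN] := geom_lt C q0 q1 a0.
by have := le_lt_trans (h N) (hN N (leqnn N)); rewrite ltxx.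
Qed.

Lemma le_addgt0 (u v : R) : (forall e, 0 < e -> u <= v + e) -> u <= v.
Proof. by move=> h; apply/ler_addgt0Pr. Qed.

Lemma nrm_limit a : (forall e, 0 < e -> nrm a <= e) -> a = 0.
Proof.
move=> h; apply: nrm_eq0; apply/eqP; rewrite eq_le nrm_ge0 andbT.
by apply: le_addgt0 => e e0; rewrite add0r h.
Qed.

Lemma geom_sum (u : nat -> A) (C q : R) : 0 <= q -> q < 1 -> 0 <= C ->
  (forall n, nrm (u n.+1 - u n) <= C * q ^+ n) ->
  forall m n, nrm (u (n + m)%N - u n) <= C / (1 - q) * q ^+ n.
Proof.
move=> q0 q1 C0 h m n.
have q1' : 0 < 1 - q by rewrite subr_gt0.
(* The bound by the exact finite geometric sum is the one that survives induction on m. *)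
suff : nrm (u (n + m)%N - u n) <= C / (1 - q) * (q ^+ n - q ^+ (n + m)).
  move/le_trans; apply; rewrite ler_wpM2l //.
    by rewrite divr_ge0 // ltW.
  by rewrite gerBl exprn_ge0.
elim: m => [|m IH]; first by rewrite addn0 !subrr nrm0 mulr0.
apply: le_trans (nrm_dist _ (u (n + m)%N) _) _.
rewrite addnS; apply: le_trans (lerD (h _) IH) _.
rewrite le_eqVlt; apply/orP; left; apply/eqP.
by rewrite exprS; field; rewrite gt_eqF.
Qed.

(** Completeness of the algebra enters here; the limits constructed later all come from this
    lemma. *)
Lemma geom_cvg (u : nat -> A) (C q : R) : 0 <= q -> q < 1 -> 0 <= C ->
  (forall n, nrm (u n.+1 - u n) <= C * q ^+ n) ->
  exists l : A, forall n, nrm (u n - l) <= C / (1 - q) * q ^+ n.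
Proof.
move=> q0 q1 C0 h.
have hs := geom_sum q0 q1 C0 h.
have cu : cauchy (u @ \oo).
  apply/cauchyP => e; rewrite ltcE => /andP[/eqP/= Ie e0].
  have [N hN] := geom_lt (C / (1 - q)) q0 q1 e0.
  exists (u N); exists N => // n /= Nn.
  rewrite -ball_normE /= nrmE ltcE /= Ie eqxx /= nrm_distC -(subnKC Nn).
  exact: le_lt_trans (hs _ _) (hN _ _).
have /cvg_ex[l hl] : cvg (u @ \oo) by apply: cstar_complete.
exists l => n; apply: le_addgt0 => e e0.
have eC : 0 < e%:C%C :> R[i] by rewrite ltcR.
have /cvgrPdist_lt/(_ _ eC)[N _ hN] := hl.
have := hN (n + N)%N (leq_addl _ _); rewrite /= nrmE ltcR => h1.
apply: le_trans (nrm_dist _ (u (n + N)%N) _) _.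
by apply: lerD; rewrite nrm_distC ?hs // ltW.
Qed.

End Norm.

(** * Positive elements *)

Section Order.
Context {R : realType} {A : cstar_alg R}.
Implicit Types (a b c e s y z : A) (r t : R).

(** The rate is kept because it later exhibits resolvents as norm limits of polynomials
    ([cl_resolvent]). *)
Lemma neumann e : nrm e < 1 -> 1 - e \is a GRing.unit /\
  exists C, forall n, nrm ((1 - e)^-1 - \sum_(k < n) e ^+ k) <= C * nrm e ^+ n.
Proof.
move=> e1; have e0 := nrm_ge0 e.
pose u n := \sum_(k < n) e ^+ k.
have du n : nrm (u n.+1 - u n) <= 1 * nrm e ^+ n.
  by rewrite /u big_ord_recr /= [_ + e ^+ n]addrC addrK mul1r nrmX.
have [l hl] := geom_cvg e0 e1 ler01 du.
have uL n : u n * (1 - e) = 1 - e ^+ n.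
  elim: n => [|n IH]; first by rewrite /u big_ord0 mul0r expr0 subrr.
  rewrite /u big_ord_recr /= mulrDl IH exprSr.
  by nc_ring.
have uR n : (1 - e) * u n = 1 - e ^+ n.
  elim: n => [|n IH]; first by rewrite /u big_ord0 mulr0 expr0 subrr.
  rewrite /u big_ord_recr /= mulrDr IH exprS.
  by nc_ring.
set C := 1 / (1 - nrm e) in hl.
have bnd n w : w = (l - u n) * (1 - e) - e ^+ n \/
    w = (1 - e) * (l - u n) - e ^+ n ->
    nrm w <= (C * nrm (1 - e) + 1) * nrm e ^+ n.
  move=> h.
  have : nrm w <= nrm (l - u n) * nrm (1 - e) + nrm e ^+ n.
    case: h => ->; apply: le_trans (nrmB _ _) _; apply: lerD (nrmX _ _).
      exact: nrmM.
    by rewrite mulrC; exact: nrmM.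
  move/le_trans; apply; rewrite mulrDl mul1r lerD2r mulrAC.
  by rewrite ler_wpM2r ?nrm_ge0 // nrm_distC.
have l1 : l * (1 - e) = 1.
  apply/subr0_eq/(nrm_small e0 e1) => n; apply: bnd; left.
  by rewrite mulrBl uL; nc_ring.
have l2 : (1 - e) * l = 1.
  apply/subr0_eq/(nrm_small e0 e1) => n; apply: bnd; right.
  by rewrite mulrBr uR; nc_ring.
have ue : 1 - e \is a GRing.unit by apply/unitrP; exists l.
split=> //; exists C => n.
have -> : (1 - e)^-1 = l by apply: (mulIr ue); rewrite mulVr.
by rewrite nrm_distC; exact: hl.
Qed.

(** The root solves y = (e + y^2) / 2, iterated from 0. The iterates stay in the ball of radius
    ||e|| < 1, where the map has Lipschitz constant ||e||; being real polynomials in e, they are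
    selfadjoint and commute with whatever commutes with e. *)
Lemma sqrt_one_sub e : star e = e -> nrm e < 1 ->
  exists y, [/\ star y = y, nrm y <= nrm e, (1 - y) * (1 - y) = 1 - e
    & forall z, z * e = e * z -> z * y = y * z].
Proof.
move=> se e1; have e0 := nrm_ge0 e.
pose u := fix u n := if n is n'.+1 then 2^-1 *:c (e + u n' * u n') else 0 : A.
have uS n : u n.+1 = 2^-1 *:c (e + u n * u n) by [].
have nu n : nrm (u n) <= nrm e.
  elim: n => [|n IH]; first by rewrite nrm0.
  rewrite uS nrmZr ger0_norm ?invr_ge0 ?ler0n //.
  have := nrmD e (u n * u n); have := nrmM (u n) (u n).
  have : nrm (u n) * nrm (u n) <= 1 * nrm e.
    by apply: ler_pM => //; rewrite ?nrm_ge0 // (le_trans IH) ?ltW.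
  by lra.
have du n : nrm (u n.+1 - u n) <= 1 * nrm e ^+ n.
  elim: n => [|n IH].
    rewrite uS mulr0 addr0 subr0 nrmZr ger0_norm ?invr_ge0 ?ler0n // expr0.
    by lra.
  have -> : u n.+2 - u n.+1 =
      2^-1 *:c (u n.+1 * (u n.+1 - u n) + (u n.+1 - u n) * u n).
    by rewrite (uS n.+1) {3}(uS n); nc_ring.
  rewrite nrmZr ger0_norm ?invr_ge0 ?ler0n //.
  have := nrmD (u n.+1 * (u n.+1 - u n)) ((u n.+1 - u n) * u n).
  have := nrmM (u n.+1) (u n.+1 - u n).
  have := nrmM (u n.+1 - u n) (u n).
  have : nrm (u n.+1) * nrm (u n.+1 - u n) <= nrm e * nrm (u n.+1 - u n).
    by rewrite ler_wpM2r ?nrm_ge0.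
  have : nrm (u n.+1 - u n) * nrm (u n) <= nrm e * nrm (u n.+1 - u n).
    by rewrite mulrC ler_wpM2r ?nrm_ge0.
  have : nrm e * nrm (u n.+1 - u n) <= nrm e * nrm e ^+ n.
    by rewrite ler_wpM2l // -[leRHS]mul1r.
  by rewrite exprS; lra.
have [y hy] := geom_cvg e0 e1 ler01 du.
set C := 1 / (1 - nrm e) in hy.
have ny : nrm y <= nrm e.
  apply: le_addgt0 => h h0.
  have [N hN] := geom_lt C e0 e1 h0.
  rewrite -[y](subrKC (u N)); apply: le_trans (nrmD _ _) _.
  apply: lerD (nu N) _; rewrite nrm_distC.
  by apply: le_trans (hy N) (ltW (hN N _)).
exists y; split.
- apply/subr0_eq/(nrm_small (C := 2 * C) e0 e1) => n.
  have su : star (u n) = u n.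
    elim: n => [|n IH]; first by rewrite star0.
    by rewrite uS starZr starD starM IH se.
  have -> : star y - y = star (y - u n) + (u n - y).
    by rewrite starB su; nc_ring.
  apply: le_trans (nrmD _ _) _; rewrite nrm_star nrm_distC.
  by have := hy n; lra.
- exact: ny.
- suff -> : e = 2 *:c y - y * y by nc_ring.
  apply/subr0_eq/(nrm_small (C := 4 * C) e0 e1) => n.
  have -> : e - (2 *:c y - y * y) =
    2 *:c (u n.+1 - y) - (u n * (u n - y) + (u n - y) * y).
    by rewrite uS; nc_ring.
  apply: le_trans (nrmB _ _) _; rewrite nrmZr ger0_norm ?ler0n //.
  have := nrmD (u n * (u n - y)) ((u n - y) * y).
  have := nrmM (u n) (u n - y); have := nrmM (u n - y) y.
  have : nrm (u n) * nrm (u n - y) <= 1 * nrm (u n - y).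
    by rewrite ler_wpM2r ?nrm_ge0 // (le_trans (nu n)) ?ltW.
  have : nrm (u n - y) * nrm y <= 1 * nrm (u n - y).
    by rewrite mulrC ler_wpM2r ?nrm_ge0 // (le_trans ny) ?ltW.
  have : nrm (u n.+1 - y) <= C * nrm e ^+ n.
    apply: le_trans (hy _) _; rewrite ler_wpM2l //.
      by rewrite divr_ge0 // subr_ge0 ltW.
    by rewrite exprS ler_piMl ?exprn_ge0 // ltW.
  by have := hy n; lra.
- move=> z ze; apply/subr0_eq/(nrm_small (C := 2 * nrm z * C) e0 e1) => n.
  have zu : z * u n = u n * z.
    elim: n => [|n IH]; first by rewrite mulr0 mul0r.
    rewrite uS -scalerAr -scalerAl mulrDr mulrDl ze mulrA IH -mulrA IH.
    by rewrite mulrA.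
  have -> : z * y - y * z = (u n - y) * z - z * (u n - y).
    by rewrite mulrBr mulrBl zu; nc_ring.
  apply: le_trans (nrmB _ _) _.
  have := nrmM (u n - y) z; have := nrmM z (u n - y).
  have : nrm z * nrm (u n - y) <= nrm z * (C * nrm e ^+ n).
    by rewrite ler_wpM2l // nrm_ge0.
  by lra.
Qed.

(** For selfadjoint a the bound says that the spectrum lies in [0, 2t], without mentioning spectra.
    In [spos] the strict inequality yields invertibility. *)
Definition pos a := star a = a /\ exists2 t, 0 <= t & nrm (t *:c 1 - a) <= t.
Definition spos a := star a = a /\ exists t, nrm (t *:c 1 - a) < t.

Lemma star_rs t : star (t *:c 1 : A) = t *:c 1.
Proof. by rewrite starZr star1. Qed.

Lemma spos_pos a : spos a -> pos a.
Proof.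
case=> sa [t ht]; split=> //; exists t; last exact: ltW.
exact: le_trans (nrm_ge0 _) (ltW ht).
Qed.

Lemma pos_rs t : 0 <= t -> pos (t *:c 1).
Proof.
by move=> t0; split; [exact: star_rs | exists t; rewrite // subrr nrm0].
Qed.

Lemma posD a b : pos a -> pos b -> pos (a + b).
Proof.
move=> [sa [t t0 ha]] [sb [r r0 hb]]; split; first by rewrite starD sa sb.
exists (t + r); first exact: addr_ge0.
have -> : (t + r) *:c 1 - (a + b) = (t *:c 1 - a) + (r *:c 1 - b) by nc_ring.
by apply: le_trans (nrmD _ _) _; apply: lerD.
Qed.

Lemma posZ r a : 0 <= r -> pos a -> pos (r *:c a).
Proof.
move=> r0 [sa [t t0 ha]]; split; first by rewrite starZr sa.
exists (r * t); first exact: mulr_ge0.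
have -> : (r * t) *:c 1 - r *:c a = r *:c (t *:c 1 - a) by nc_ring.
by rewrite nrmZr ger0_norm // ler_wpM2l.
Qed.

Lemma spos_shift a r : pos a -> 0 < r -> spos (a + r *:c 1).
Proof.
move=> [sa [t t0 ha]] r0; split; first by rewrite starD sa star_rs.
exists (t + r).
have -> : (t + r) *:c 1 - (a + r *:c 1) = t *:c 1 - a by nc_ring.
by lra.
Qed.

Lemma spos_normalize a : spos a -> exists t e,
  [/\ 0 < t, star e = e, nrm e < 1 & a = t *:c (1 - e)].
Proof.
move=> [sa [t ht]]; have t0 := le_lt_trans (nrm_ge0 _) ht.
exists t, (t^-1 *:c (t *:c 1 - a)); split=> //.
- by rewrite starZr starB star_rs sa.
- rewrite nrmZr ger0_norm ?invr_ge0 ?ltW // mulrC ltr_pdivrMr //.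
  by rewrite mul1r.
- have h : t%:C%C * t^-1%:C%C = 1 :> R[i].
    by rewrite -rmorphM /= mulfV ?gt_eqF.
  rewrite scalerBr scalerA h scale1r.
  by nc_ring.
Qed.

Lemma spos_unit a : spos a -> a \is a GRing.unit.
Proof.
move=> /spos_normalize[t [e [t0 _ e1 ->]]].
rewrite scaler_unit; first by case: (neumann e1).
by rewrite unitfE (fmorph_eq0 (real_complex R)) gt_eqF.
Qed.

Lemma spos_sqrt a : spos a -> exists s, [/\ star s = s, s * s = a, spos s
  & forall z, z * a = a * z -> z * s = s * z].
Proof.
move=> /spos_normalize[t [e [t0 se e1 ->]]].
have [y [sy ye y2 yc]] := sqrt_one_sub se e1.
have t0' : 0 < Num.sqrt t by rewrite sqrtr_gt0.
have tt : (Num.sqrt t)%:C%C * (Num.sqrt t)%:C%C = t%:C%C :> R[i].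
  by rewrite -rmorphM /= -expr2 sqr_sqrtr ?ltW.
exists (Num.sqrt t *:c (1 - y)); split.
- by rewrite starZr starB star1 sy.
- by rewrite -scalerAl -scalerAr scalerA tt y2.
- split; first by rewrite starZr starB star1 sy.
  exists (Num.sqrt t).
  have -> : Num.sqrt t *:c 1 - Num.sqrt t *:c (1 - y) = Num.sqrt t *:c y.
    by nc_ring.
  rewrite nrmZr gtr0_norm // gtr_pMr //.
  exact: le_lt_trans e1.
- move=> z; rewrite -scalerAr -scalerAl => h.
  have tn : t%:C%C != 0 :> R[i] by rewrite (fmorph_eq0 (real_complex R)) gt_eqF.
  have {h} := scalerI tn h.
  rewrite mulrBr mulrBl mulr1 mul1r => /addrI/oppr_inj/yc zy.
  by rewrite -scalerAr -scalerAl mulrBr mulrBl mulr1 mul1r zy.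
Qed.

(* The element [u = y + i g], with [g] the square root of [T - y^2], satisfies
   [u* u = T]; both [y] and [g] are real or imaginary parts of [u]. *)
Lemma unitary_dilation y (T : R) : 0 <= T -> star y = y ->
  spos (T *:c 1 - y * y) ->
  nrm y ^+ 2 <= T /\ nrm (T *:c 1 - y * y) <= T.
Proof.
move=> T0 sy /spos_sqrt[g [sg g2 _ gc]].
have yg : y * g = g * y.
  by apply: gc; rewrite mulrBr mulrBl -scalerAr -scalerAl mulr1 mul1r mulrA.
pose u := y + 'i *: g.
have su : star u = y - 'i *: g by rewrite /u starD sy starZi sg scaleNr.
have nu : nrm u ^+ 2 = T.
  rewrite -nrm_cstar su /u.
  have -> : (y - 'i *: g) * (y + 'i *: g) = T *:c 1.
    have -> : T *:c 1 = y * y + g * g by rewrite g2; nc_ring.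
    have ii : 'i * 'i = -1 :> R[i] by rewrite -expr2 sqrCi.
    have -> : (y - 'i *: g) * (y + 'i *: g) =
      y * y - ('i * 'i) *: (g * g) + 'i *: (y * g - g * y) by nc_ring.
    by rewrite yg ii; nc_ring.
  by rewrite nrm_rs ger0_norm.
have nu' : nrm (star u) = nrm u by rewrite nrm_star.
have half2 : 2^-1%:C%C + 2^-1%:C%C = 1 :> R[i].
  by rewrite -rmorphD /=; congr (_%:C%C); field.
have h2 : 0 <= 2^-1 :> R by rewrite invr_ge0 ler0n.
have ny : nrm y <= nrm u.
  have -> : y = 2^-1 *:c (u + star u).
    rewrite su /u -[LHS]scale1r -half2; nc_ring.
  rewrite nrmZr ger0_norm //; have := nrmD u (star u); rewrite nu'; lra.
have ng : nrm g <= nrm u.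
  rewrite -nrmZi.
  have -> : 'i *: g = 2^-1 *:c (u - star u).
    rewrite su /u -[LHS]scale1r -half2; nc_ring.
  rewrite nrmZr ger0_norm //; have := nrmB u (star u); rewrite nu'; lra.
split; first by rewrite -nu ler_sqr ?nnegrE ?nrm_ge0.
rewrite -g2 -nu; apply: le_trans (nrmM _ _) _.
by rewrite -expr2 ler_sqr ?nnegrE ?nrm_ge0.
Qed.

(** For T = ||y||^2 + 1 the element T - y^2 is [spos], its distance to T being ||y^2|| < T;
    [unitary_dilation] then bounds ||T - y^2|| by T. *)
Lemma pos_sqr y : star y = y -> pos (y * y).
Proof.
move=> sy; split; first by rewrite starM sy.
have T0 : 0 <= nrm y ^+ 2 + 1 by rewrite addr_ge0 // exprn_ge0 ?nrm_ge0.
exists (nrm y ^+ 2 + 1) => //.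
apply: (unitary_dilation T0 sy _).2; split.
  by rewrite starB star_rs starM sy.
exists (nrm y ^+ 2 + 1); rewrite subKr.
by have := nrmM y y; rewrite -expr2; lra.
Qed.

(** Each root commutes with everything that commutes with its square, so the roots s and t commute
    and a b is the square of the selfadjoint element s t. *)
Lemma spos_comm_mul a b : spos a -> spos b -> a * b = b * a -> pos (a * b).
Proof.
move=> /spos_sqrt[s [ss <- _ sc]] /spos_sqrt[t [st <- _ tc]] ab.
have st' : s * t = t * s by apply: tc; symmetry; apply: sc; symmetry.
have -> : s * s * (t * t) = (s * t) * (s * t).
  by rewrite -!mulrA; congr (_ * _); rewrite !mulrA st'.
by apply: pos_sqr; rewrite starM ss st st'.
Qed.

(** The product (s - y)(s + y) = s^2 - y^2 of commuting positive factors is positive, and the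
    dilation turns this into ||y||^2 <= s^2. The shifts e and h make the factors, then the product,
    strictly positive. *)
Lemma pos_nrm_le y (s : R) : 0 <= s -> star y = y ->
  pos (s *:c 1 - y) -> pos (s *:c 1 + y) -> nrm y <= s.
Proof.
move=> s0 sy p1 p2; apply: le_addgt0 => e e0.
have q1 := spos_shift p1 e0; have q2 := spos_shift p2 e0.
have se0 : 0 <= s + e by lra.
rewrite -ler_sqr ?nnegrE ?nrm_ge0 //.
apply: le_addgt0 => h h0.
apply: (unitary_dilation _ sy _).1; first by rewrite addr_ge0 ?sqr_ge0 ?ltW.
have -> : ((s + e) ^+ 2 + h) *:c 1 - y * y =
    (s *:c 1 - y + e *:c 1) * (s *:c 1 + y + e *:c 1) + h *:c 1.
  by rewrite expr2; nc_ring.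
apply: spos_shift => //; apply: spos_comm_mul => //.
by nc_ring.
Qed.

Lemma pos_sub_rs a t : star a = a -> nrm a <= t -> pos (t *:c 1 - a).
Proof.
move=> sa at'; split; first by rewrite starB star_rs sa.
by exists t; rewrite ?subKr // (le_trans (nrm_ge0 a)).
Qed.

(** The radius t witnessing positivity may vary with e. The fixed radius t = ||a|| works, since
    [pos_nrm_le] bounds ||t - a|| by t + e for every e. *)
Lemma pos_closed a : star a = a ->
  (forall e : R, 0 < e -> pos (a + e *:c 1)) -> pos a.
Proof.
move=> sa h; split=> //; exists (nrm a); first exact: nrm_ge0.
apply: le_addgt0 => e e0; apply: pos_nrm_le.
- by rewrite addr_ge0 ?nrm_ge0 ?ltW.
- by rewrite starB star_rs sa.
- have -> : (nrm a + e) *:c 1 - (nrm a *:c 1 - a) = a + e *:c 1 by nc_ring.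
  exact: h.
- have -> : (nrm a + e) *:c 1 + (nrm a *:c 1 - a) =
    (nrm a + e + nrm a) *:c 1 - a by nc_ring.
  by apply: pos_sub_rs => //; have := nrm_ge0 a; lra.
Qed.

Lemma pos_limit a : (forall e : R, 0 < e -> exists2 b, pos b & nrm (b - a) <= e) ->
  pos a.
Proof.
move=> h; have sa : star a = a.
  apply/subr0_eq/nrm_limit => e e0.
  have e2 : 0 < e / 2 by rewrite divr_gt0.
  have [b [sb _] hb] := h _ e2.
  have -> : star a - a = (b - a) - star (b - a) by rewrite starB sb; nc_ring.
  by apply: le_trans (nrmB _ _) _; rewrite nrm_star; lra.
apply: pos_closed => // e e0; have [b pb hb] := h e e0.
have -> : a + e *:c 1 = b + (e *:c 1 - (b - a)) by nc_ring.
apply: posD => //; apply: pos_sub_rs => //.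
by rewrite starB sa; case: pb => ->.
Qed.

Lemma pos_comm_mul a b : pos a -> pos b -> a * b = b * a -> pos (a * b).
Proof.
move=> pa pb ab; apply: pos_limit => e e0.
pose h := Num.min 1 (e / (nrm a + nrm b + 1)).
have d0 : 0 < nrm a + nrm b + 1 by have := nrm_ge0 a; have := nrm_ge0 b; lra.
have h0 : 0 < h by rewrite lt_min ltr01 divr_gt0.
exists ((a + h *:c 1) * (b + h *:c 1)).
  apply: spos_comm_mul; [exact: spos_shift|exact: spos_shift|].
  rewrite !(mulrDl, mulrDr) ab; nc_ring.
have -> : (a + h *:c 1) * (b + h *:c 1) - a * b = h *:c (a + b + h *:c 1).
  by nc_ring.
rewrite nrmZr gtr0_norm //.
have h1 : h <= 1 by rewrite ge_min lexx.
have h2 : h <= e / (nrm a + nrm b + 1) by rewrite ge_min lexx orbT.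
have : h * nrm (a + b + h *:c 1) <= e / (nrm a + nrm b + 1) * (nrm a + nrm b + 1).
  apply: ler_pM => //; rewrite ?nrm_ge0 ?(ltW h0) //.
  have := nrmD (a + b) (h *:c 1); have := nrmD a b.
  by rewrite nrm_rs gtr0_norm //; lra.
by rewrite divfK // gt_eqF.
Qed.

End Order.

(** * The order of a C*-algebra *)

Definition leA {R : realType} {A : cstar_alg R} (a b : A) := pos (b - a).
Notation "a <=p b" := (leA a b) (at level 70, no associativity) : ring_scope.

Section KelleyVaught.
Context {R : realType} {A : cstar_alg R}.
Implicit Types (a b c d e m n p q u v w x y z : A) (r s t : R).

Lemma sposZ r a : 0 < r -> spos a -> spos (r *:c a).
Proof.
move=> r0 [sa [t ht]]; split; first by rewrite starZr sa.
exists (r * t).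
have -> : (r * t) *:c 1 - r *:c a = r *:c (t *:c 1 - a) by nc_ring.
by rewrite nrmZr gtr0_norm // ltr_pM2l.
Qed.

Lemma nrm_sqr a : star a = a -> nrm (a * a) = nrm a ^+ 2.
Proof. by move=> sa; rewrite -nrm_cstar sa. Qed.

Lemma pos_nrm a s : 0 <= s -> pos a -> a <=p s *:c 1 -> nrm a <= s.
Proof.
move=> s0 pa h; apply: pos_nrm_le => //; first by case: pa.
by apply: posD => //; apply: pos_rs.
Qed.

Lemma pos_star_sum x : pos (star x * x + x * star x).
Proof.
have sq1 : star (x + star x) = x + star x by rewrite starD starK addrC.
have sq2 : star ('i *: (x - star x)) = 'i *: (x - star x).
  by rewrite starZi starB starK scaleNr -scalerN opprB.
have ii : 'i * 'i = -1 :> R[i] by rewrite -expr2 sqrCi.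
have -> : star x * x + x * star x = 2^-1 *:c
    ((x + star x) * (x + star x) +
     ('i *: (x - star x)) * ('i *: (x - star x))).
  by rewrite -scalerAl -scalerAr scalerA ii; nc_ring.
by apply: posZ; [rewrite invr_ge0 ler0n | apply: posD; apply: pos_sqr].
Qed.

(* With [m = sqrt (a^2 + e)] and [q = m - a], which stands for twice the
   negative part of [a], [q] has a square root [n] commuting with [a]. *)
Lemma approx_neg_part a (e : R) : star a = a -> 0 < e ->
  exists m n, [/\ pos m, star n = n, n * n = m - a, n * a = a * n
    & 2 *:c (a * (m - a)) = e *:c 1 - (m - a) * (m - a)].
Proof.
move=> sa e0.
have [m [sm m2 pm mc]] := spos_sqrt (spos_shift (pos_sqr sa) e0).
have am : a * m = m * a.
  by apply: mc; rewrite mulrDr mulrDl mulrA -scalerAr -scalerAl mulr1 mul1r.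
pose q := m - a.
have sq : star q = q by rewrite starB sm sa.
have aq : a * q = q * a by rewrite mulrBr mulrBl am.
have mq : m * q = q * m by rewrite mulrBr mulrBl am.
have qw : q * (2 *:c m) = q * q + e *:c 1.
  have -> : q * (2 *:c m) = q * q + (m * m - a * a + (m * a - a * m)).
    by rewrite /q; nc_ring.
  by rewrite am m2; nc_ring.
(* As q (2 m) = q^2 + e with 2 m and q^2 + e strictly positive, the root of q is (q^2 + e)^(1/2) (2
   m)^(-1/2), that is s1 times the inverse of s2. *)
have [s2 [ss2 s22 ps2 s2c]] := spos_sqrt (sposZ (ltr0Sn R 1) pm).
have [s1 [ss1 s12 ps1 s1c]] := spos_sqrt (spos_shift (pos_sqr sq) e0).
have us2 := spos_unit ps2.
have cw z : z * m = m * z -> z * s2 = s2 * z.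
  by move=> zm; apply: s2c; rewrite -scalerAr -scalerAl zm.
have cq z : z * q = q * z -> z * s1 = s1 * z.
  move=> zq; apply: s1c.
  have zqq : z * (q * q) = q * q * z by rewrite mulrA zq -mulrA zq mulrA.
  have -> : z * (q * q + e *:c 1) = z * (q * q) + e *:c z by nc_ring.
  by rewrite zqq; nc_ring.
have s21 : s2 * s1 = s1 * s2.
  by apply: cq; symmetry; apply: cw.
pose i := s2^-1.
have is1 : i * s1 = s1 * i by symmetry; apply: commrV.
have ai : a * i = i * a by apply: commrV; apply: cw.
have sI : star i = i by rewrite /i star_inv // ss2.
exists m, (s1 * i); split.
- exact: spos_pos.
- by rewrite starM sI ss1 is1.
- have uw : 2 *:c m \is a GRing.unit by rewrite -s22 unitrMl.
  apply: (mulIr uw); rewrite -/q qw -s12 -s22.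
  have i2 : i * s2 = 1 by rewrite mulVr.
  have -> : s1 * i * (s1 * i) * (s2 * s2) = s1 * (i * s1) * (i * s2) * s2.
    by nc_ring.
  by rewrite i2 is1 mulr1 -!mulrA i2 mulr1.
- by rewrite -mulrA -ai mulrA -(cq a) // -mulrA.
- have -> : 2 *:c (a * (m - a)) = m * m - a * a + (a * m - m * a) - q * q.
    by rewrite /q; nc_ring.
  by rewrite am m2 /q; nc_ring.
Qed.

(* Kelley-Vaught.  With [d = c n] as in [approx_neg_part], [d* d] is almost
   negative; so are [x* x] and [x x*] for [x = d q], while their sum is
   positive, which forces [q] to be small. *)
Lemma pos_starM c : pos (star c * c).
Proof.
set a := star c * c.
have sa : star a = a by rewrite /a starM starK.
apply: pos_limit => h h0.
have A0 := nrm_ge0 a.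
(* Chosen so that the bound ||q||^4 <= e (||q||^2 + 2 ||a|| ||q||) below forces ||q|| <= h. *)
pose e := h ^+ 3 / (h + 2 * nrm a).
have hA : 0 < h + 2 * nrm a by lra.
have e0 : 0 < e by rewrite divr_gt0 // exprn_gt0.
have [m [n [pm sn n2 na]]] := approx_neg_part sa e0.
set q := m - a in n2 *; move=> aq.
have sq : star q = q by rewrite /q starB sa; case: pm => ->.
exists m => //; rewrite -/q.
pose d := c * n; pose v := d * star d; pose x := d * q.
have dd : star d * d = a * q.
  rewrite /d starM sn -mulrA [star c * _]mulrA -/a mulrA na -mulrA n2.
  by [].
have sv : star v = v by rewrite /v starM starK.
have nv : nrm v <= nrm a * nrm q.
  by rewrite /v -{1}(starK d) nrm_cstar nrm_star -nrm_cstar dd nrmM.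
have xx1 : 2 *:c (star x * x) = e *:c (q * q) - q * q * (q * q).
  rewrite /x starM sq -mulrA [star d * _]mulrA dd.
  have -> : 2 *:c (q * (a * q * q)) = q * (2 *:c (a * q)) * q by nc_ring.
  by rewrite aq; nc_ring.
have xx2 : x * star x = e *:c v - 2 *:c (v * v).
  rewrite /x starM sq.
  have qq : q * q = e *:c 1 - 2 *:c (star d * d) by rewrite dd aq; nc_ring.
  have -> : d * q * (q * star d) = d * (q * q) * star d by nc_ring.
  by rewrite qq /v; nc_ring.
set N := nrm q ^+ 2 + 2 * (nrm a * nrm q).
have q0 := nrm_ge0 q.
have N0 : 0 <= N by rewrite addr_ge0 ?sqr_ge0 // mulr_ge0 // mulr_ge0.
(* By [xx1] and [xx2], twice the positive sum is e (q^2 + 2 v) - q^4 - 4 v^2, hence q^4 <= e (q^2 +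
   2 v). *)
have key : nrm q ^+ 4 <= e * N.
  have sqq : star (q * q) = q * q by rewrite starM sq.
  have -> : nrm q ^+ 4 = nrm (q * q * (q * q)).
    by rewrite !nrm_sqr // -exprM.
  apply: pos_nrm; [by rewrite mulr_ge0 // ltW | exact: pos_sqr |].
  rewrite /leA.
  have -> : (e * N) *:c 1 - q * q * (q * q) =
      e *:c (N *:c 1 - (q * q + 2 *:c v)) +
      (2 *:c (star x * x + x * star x) + 4 *:c (v * v)).
    by rewrite [2 *:c (_ + _)]scalerDr xx1 xx2; nc_ring.
  apply: posD.
    apply: posZ; first exact: ltW.
    apply: pos_sub_rs; first by rewrite starD sqq starZr sv.
    apply: le_trans (nrmD _ _) _; rewrite nrm_sqr // nrmZr gtr0_norm //.
    by rewrite /N; lra.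
  apply: posD; first by apply: posZ => //; apply: pos_star_sum.
  by apply: posZ => //; apply: pos_sqr.
rewrite leNgt; apply/negP => hq.
have qp : 0 < nrm q by lra.
have : nrm q ^+ 3 * (h + 2 * nrm a) <= h ^+ 3 * (nrm q + 2 * nrm a).
  rewrite -ler_pdivlMr // mulrAC -/e.
  rewrite -(ler_pM2r qp) -exprSr; apply: le_trans key _.
  by rewrite /N; lra.
have : h ^+ 3 * nrm q < nrm q ^+ 3 * h.
  have -> : h ^+ 3 * nrm q = (h * nrm q) * h ^+ 2 by ring.
  have -> : nrm q ^+ 3 * h = (h * nrm q) * nrm q ^+ 2 by ring.
  by rewrite ltr_pM2l ?mulr_gt0 // ltr_sqr ?nnegrE // ltW.
have : h ^+ 3 * nrm a <= nrm q ^+ 3 * nrm a.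
  by rewrite ler_wpM2r // lerXn2r ?nnegrE // ltW.
lra.
Qed.

(** After the shift p + k = s^2 the conjugate is [star (s * c) * (s * c)]; the size of k keeps the
    error k [star c * c] below e. *)
Lemma pos_conj c p : pos p -> pos (star c * p * c).
Proof.
move=> pp; have sp : star p = p by case: pp.
apply: pos_closed; first by rewrite !starM starK sp mulrA.
move=> e e0.
have k0 : 0 < e / (nrm c ^+ 2 + 1).
  by rewrite divr_gt0 // ltr_wpDl ?sqr_ge0.
have [s [ss s2 _ _]] := spos_sqrt (spos_shift pp k0).
set k := e / _ in k0 s2.
have -> : star c * p * c + e *:c 1 =
    star (s * c) * (s * c) + (e *:c 1 - k *:c (star c * c)).
  have -> : star (s * c) * (s * c) = star c * (s * s) * c.
    by rewrite starM ss !mulrA.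
  by rewrite s2; nc_ring.
apply: posD; first exact: pos_starM.
apply: pos_sub_rs; first by rewrite starZr starM starK.
rewrite nrmZr gtr0_norm // nrm_cstar /k mulrAC ler_pdivrMr.
  by rewrite ler_pM2l //; lra.
by rewrite ltr_wpDl ?sqr_ge0.
Qed.

Lemma nonneg_pos a : nonneg a -> pos a.
Proof. by case=> c ->; exact: pos_starM. Qed.

Lemma spos_nonneg a : spos a -> nonneg a.
Proof. by move=> /spos_sqrt[s [ss <- _ _]]; exists s; rewrite ss. Qed.


Lemma leA_refl a : a <=p a.
Proof. by rewrite /leA subrr -(scale0r 1); apply: pos_rs. Qed.

Lemma leA_trans a b c : a <=p b -> b <=p c -> a <=p c.
Proof. by move=> h1 h2; rewrite /leA -(subrKA b) addrC addrC; apply: posD. Qed.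

Lemma leAZ r a b : 0 <= r -> a <=p b -> r *:c a <=p r *:c b.
Proof. by move=> r0 h; rewrite /leA -scalerBr; apply: posZ. Qed.

Lemma leA_conj c a b : a <=p b -> star c * a * c <=p star c * b * c.
Proof. by move=> h; rewrite /leA -mulrBl -mulrBr; apply: pos_conj. Qed.

Lemma leA_rs r s : r <= s -> (r *:c 1 : A) <=p s *:c 1.
Proof.
move=> h; rewrite /leA -scalerBl -rmorphB /=.
by apply: pos_rs; rewrite subr_ge0.
Qed.

Lemma pos_le a b : pos a -> a <=p b -> pos b.
Proof. by move=> h1 h2; rewrite -(subrK a b); apply: posD. Qed.

Lemma sa_le_nrm a : star a = a -> a <=p nrm a *:c 1.
Proof. by move=> sa; apply: pos_sub_rs. Qed.

Lemma nrm_mono a b : pos a -> a <=p b -> nrm a <= nrm b.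
Proof.
move=> pa ab; apply: pos_nrm => //; first exact: nrm_ge0.
by apply: (leA_trans ab); apply: sa_le_nrm; case: (pos_le pa ab).
Qed.

Lemma starM_le c r : nrm c <= r -> star c * c <=p (r ^+ 2) *:c 1.
Proof.
move=> h; apply: pos_sub_rs; first by rewrite starM starK.
by rewrite nrm_cstar lerXn2r ?nnegrE ?nrm_ge0 // (le_trans (nrm_ge0 c)).
Qed.

Lemma pos_inv a : spos a -> pos a^-1.
Proof.
move=> pa; have ua := spos_unit pa.
have [s [ss s2 ps _]] := spos_sqrt pa; have us := spos_unit ps.
have -> : a^-1 = s^-1 * s^-1 by rewrite -s2 invrM.
by apply: pos_sqr; rewrite star_inv // ss.
Qed.

Lemma spos_ge a (e : R) : 0 < e -> e *:c 1 <=p a -> spos a.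
Proof.
by move=> e0 h; rewrite -(subrK (e *:c 1) a); apply: spos_shift.
Qed.

(** Invertibility gives the lower bound e = 1 / ||a^-1|| at the level of squares, a^2 >= e^2;
    multiplying a^2 - e^2 by the commuting positive element (a + e)^-1 descends to a >= e. *)
Lemma strictly_posP a :
  strictly_pos a <-> exists2 e : R, 0 < e & e *:c 1 <=p a.
Proof.
split; last first.
  move=> [e e0 /(spos_ge e0) h]; split; [exact: spos_nonneg|exact: spos_unit].
move=> [/nonneg_pos pa ua].
have sa : star a = a by case: pa.
have k0 : 0 < nrm a^-1.
  rewrite lt_def nrm_ge0 andbT; apply/eqP => /nrm_eq0 h.
  by have := unitr0 A; rewrite -h unitrV ua.
pose e : R := (nrm a^-1)^-1.
have e0 : 0 < e by rewrite invr_gt0.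
exists e => //.
have p1 : pos (a * a - (e ^+ 2) *:c 1).
  have -> : a * a - (e ^+ 2) *:c 1 = e ^+ 2 *:c
     (star a * ((nrm a^-1) ^+ 2 *:c 1 - a^-1 * a^-1) * a).
    have -> : star a * ((nrm a^-1) ^+ 2 *:c 1 - a^-1 * a^-1) * a =
        (nrm a^-1) ^+ 2 *:c (a * a) - 1.
      rewrite sa mulrBr mulrBl [a * (a^-1 * _)]mulrA mulrV // mul1r mulVr //.
      by nc_ring.
    rewrite scalerBr scalerA -rmorphM /= -exprMn mulVf ?gt_eqF // expr1n.
    by rewrite scale1r.
  apply: posZ; first exact: sqr_ge0.
  apply: pos_conj; apply: pos_sub_rs; first by rewrite starM star_inv ?sa.
  by apply: le_trans (nrmM _ _) _; rewrite expr2.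
have pe : spos (a + e *:c 1) by apply: spos_shift.
have ue := spos_unit pe.
have fact : (a - e *:c 1) * (a + e *:c 1) = a * a - (e ^+ 2) *:c 1.
  by rewrite expr2; nc_ring.
rewrite /leA.
have -> : a - e *:c 1 = (a * a - (e ^+ 2) *:c 1) * (a + e *:c 1)^-1.
  by rewrite -fact -mulrA mulrV // mulr1.
apply: pos_comm_mul => //; first exact: pos_inv.
by apply: commrV; rewrite /GRing.comm -fact; nc_ring.
Qed.

End KelleyVaught.

(** * Imaginary parts and dissipative elements *)

Section ImPart.
Context {R : realType} {A : cstar_alg R}.
Implicit Types (a b c r : A).

Lemma iunit2 : (2 * 'i)^-1 * (2 * 'i) = 1 :> R[i].
Proof. by rewrite mulVf // mulf_neq0 ?neq0Ci ?pnatr_eq0. Qed.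

Lemma cImK a : (2 * 'i) *: cIm a = a - star a.
Proof. by rewrite /cIm scalerA mulrC iunit2 scale1r. Qed.

Lemma cIm_eq a b : a - star a = (2 * 'i) *: b -> cIm a = b.
Proof. by rewrite /cIm => ->; rewrite scalerA iunit2 scale1r. Qed.

Lemma star_cIm a : star (cIm a) = cIm a.
Proof.
rewrite -[RHS]scale1r -iunit2 -scalerA cImK /cIm starZ starB starK.
rewrite fmorphV rmorphM /= conjCi conjC_nat mulrN invrN scaleNr -scalerN.
by rewrite opprB.
Qed.

Lemma cImD a b : cIm (a + b) = cIm a + cIm b.
Proof. by rewrite /cIm starD -scalerDr opprD addrACA. Qed.

Lemma cImN a : cIm (- a) = - cIm a.
Proof. by rewrite /cIm starN -scalerN opprD. Qed.

Lemma cImB a b : cIm (a - b) = cIm a - cIm b.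
Proof. by rewrite cImD cImN. Qed.

Lemma cIm_sa a : star a = a -> cIm a = 0.
Proof. by move=> sa; rewrite /cIm sa subrr scaler0. Qed.

Lemma nrm_cIm a : nrm (cIm a) <= nrm a.
Proof.
rewrite /cIm nrmZ normfV normrM normCi mulr1 normr_nat.
have -> : complex.Re (2^-1 : R[i]) = 2^-1.
  by rewrite -(rmorph_nat (real_complex R)) -fmorphV.
by have := nrmB a (star a); rewrite nrm_star; lra.
Qed.

Lemma cIm_inv a : a \is a GRing.unit ->
  cIm a^-1 = - (a^-1 * cIm a * star a^-1) /\
  cIm a^-1 = - (star a^-1 * cIm a * a^-1).
Proof.
move=> ua; have us := starV ua; split; apply: cIm_eq.
  rewrite scalerN scalerAl scalerAr cImK mulrBr mulrBl mulVr // mul1r.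
  by rewrite star_inv // mulrK // opprB.
rewrite scalerN scalerAl scalerAr cImK mulrBr mulrBl mulrK //.
by rewrite star_inv // mulVr // mul1r opprB.
Qed.

(* [1 + i d a] is a strict contraction for small [d > 0]: its square is
   [1 - 2 d Im a + d^2 a* a]. *)
Lemma dissipative_contraction a (e : R) : 0 < e -> e *:c 1 <=p cIm a ->
  exists2 d : R, 0 < d & nrm (1 + ('i * d%:C%C) *: a) < 1.
Proof.
move=> e0 ha; have a0 := nrm_ge0 a.
have D0 : 0 < nrm a ^+ 2 + e ^+ 2 + 1.
  by rewrite ltr_wpDl // addr_ge0 ?sqr_ge0.
(* This d satisfies d e <= 1 and d ||a||^2 <= e, so the square is at most 1 - 2 d e + d e = 1 - d
   e. *)
pose d := e / (nrm a ^+ 2 + e ^+ 2 + 1).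
have d0 : 0 < d by rewrite divr_gt0.
have dD : d * (nrm a ^+ 2 + e ^+ 2 + 1) = e by rewrite divfK ?gt_eqF.
have de1 : d * e <= 1.
  rewrite /d mulrAC ler_pdivrMr // mul1r -expr2.
  by have := sqr_ge0 (nrm a); lra.
have dan : d * nrm a ^+ 2 <= e.
  have := mulr_ge0 (ltW d0) (sqr_ge0 e); have := dD; lra.
exists d => //.
suff : nrm (1 + ('i * d%:C%C) *: a) ^+ 2 < 1.
  by rewrite -[ltRHS](expr1n _ 2) ltr_sqr ?nnegrE ?nrm_ge0.
rewrite -nrm_cstar.
have s0 : 0 <= 1 - d * e by lra.
suff : nrm (star (1 + ('i * d%:C%C) *: a) * (1 + ('i * d%:C%C) *: a)) <=
    1 - d * e by have := mulr_gt0 d0 e0; lra.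
apply: pos_nrm => //; first exact: pos_starM.
have -> : star (1 + ('i * d%:C%C) *: a) * (1 + ('i * d%:C%C) *: a) =
   1 - (2 * d) *:c cIm a + d ^+ 2 *:c (star a * a).
  have ii : 'i * 'i = -1 :> R[i] by rewrite -expr2 sqrCi.
  have dc : (d%:C%C)^* = d%:C%C :> R[i].
    by rewrite conj_Creal //; apply/complex_realP; exists d.
  rewrite starD star1 starZ rmorphM /= conjCi dc.
  have -> : (2 * d) *:c cIm a = - ('i * d%:C%C) *: (a - star a).
    rewrite -cImK [RHS]scalerA; congr (_ *: _).
    have -> : - ('i * d%:C%C) * (2 * 'i) = - ('i * 'i) * (2 * d%:C%C) :> R[i].
      by ring.
    by rewrite ii opprK mul1r rmorphM /= rmorph_nat.
  have -> : d ^+ 2 *:c (star a * a) =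
     (- ('i * 'i) * d%:C%C ^+ 2) *: (star a * a).
    by rewrite ii opprK mul1r rmorphXn.
  by nc_ring.
rewrite /leA.
have -> : (1 - d * e) *:c 1 -
    (1 - (2 * d) *:c cIm a + d ^+ 2 *:c (star a * a)) =
  (2 * d) *:c (cIm a - e *:c 1) + (d * e) *:c 1 - d ^+ 2 *:c (star a * a).
  by nc_ring.
rewrite -addrA; apply: posD.
  by apply: posZ => //; rewrite mulr_ge0 // ltW.
apply: pos_sub_rs; first by rewrite starZr starM starK.
rewrite nrmZr nrm_cstar ger0_norm ?sqr_ge0 //.
by rewrite expr2 -mulrA ler_pM2l.
Qed.

Lemma dissipative_unit a (e : R) : 0 < e -> e *:c 1 <=p cIm a ->
  a \is a GRing.unit.
Proof.
move=> e0 /(dissipative_contraction e0)[d d0 h].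
have id0 : - ('i * d%:C%C) != 0 :> R[i].
  rewrite oppr_eq0 mulf_neq0 ?neq0Ci //.
  by rewrite (fmorph_eq0 (real_complex R)) gt_eqF.
have -> : a = (- ('i * d%:C%C))^-1 *: (1 - (1 + ('i * d%:C%C) *: a)).
  by rewrite opprD addNKr -scaleNr scalerA mulVf // scale1r.
rewrite scaler_unit; first by case: (neumann h).
by rewrite unitfE invr_eq0.
Qed.

(** Conjugating e <= Im a by a^-1 gives e ||a^-1||^2 <= ||Im a^-1|| <= ||a^-1||. *)
Lemma dissipative_inv a (e : R) : 0 < e -> e *:c 1 <=p cIm a ->
  nrm a^-1 <= e^-1.
Proof.
move=> e0 ha; have ua := dissipative_unit e0 ha.
have [r0|r0] := eqVneq (nrm a^-1) 0; first by rewrite r0 invr_ge0 ltW.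
have rp : 0 < nrm a^-1 by rewrite lt_def r0 nrm_ge0.
suff : e * nrm a^-1 ^+ 2 <= nrm a^-1.
  rewrite expr2 mulrA ger_pMl // => h.
  by rewrite -(ler_pM2l e0) mulfV ?gt_eqF.
have h1 := leA_conj a^-1 ha.
have := nrm_mono _ h1; rewrite -scalerAr -scalerAl mulr1 nrmZr gtr0_norm //.
rewrite nrm_cstar => h; apply: le_trans (h _) _.
  by apply: posZ; [exact: ltW | exact: pos_starM].
have [_ h2] := cIm_inv ua.
by have := nrm_cIm a^-1; rewrite h2 nrmN.
Qed.

End ImPart.

(** * Conditional expectations and resolvents *)

Section ConditionalExpectation.
Context {R : realType} {M B : cstar_alg R}.
Variables (incl : {lrmorphism B -> M}) (E : {linear M -> B}).
Hypothesis hE : opv_prob_space incl E.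
Implicit Types (a p q : M) (b m z w : B) (r e : R).

Lemma nrm_incl b : nrm (incl b) = nrm b.
Proof. by rewrite /nrm (incl_isometry hE). Qed.

Lemma incl_rs r : incl (r *:c 1) = r *:c 1.
Proof. by rewrite linearZ rmorph1. Qed.

Lemma incl_pos b : pos b -> pos (incl b).
Proof.
case=> sb [t t0 ht]; split; first by rewrite -(incl_star hE) sb.
by exists t => //; rewrite -incl_rs -rmorphB nrm_incl.
Qed.

Lemma incl_le b m : b <=p m -> incl b <=p incl m.
Proof. by move=> /incl_pos; rewrite /leA rmorphB. Qed.

Lemma cIm_incl b : cIm (incl b) = incl (cIm b).
Proof. by rewrite /cIm -(incl_star hE) -rmorphB -linearZ. Qed.

Lemma condexp_nonneg a : nonneg (E (star a * a)).
Proof.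
have [] := condexp_cp hE (n := 1) (P := const_mx (star a * a)).
  exists (const_mx a); apply/matrixP => i j.
  by rewrite !mxE big_ord1 !mxE.
move=> C /matrixP/(_ ord0 ord0); rewrite !mxE big_ord1 !mxE => h.
by exists (C ord0 ord0).
Qed.

Lemma condexp_rs r : E (r *:c 1) = r *:c 1.
Proof. by rewrite linearZ (condexp_unit hE). Qed.

Lemma condexp_pos a : pos a -> pos (E a).
Proof.
move=> pa; apply: pos_limit => e e0; exists (E a + e *:c 1).
  rewrite -condexp_rs -linearD; have [s [ss <- _ _]] := spos_sqrt (spos_shift pa e0).
  by rewrite -{1}ss; apply: nonneg_pos; apply: condexp_nonneg.
by rewrite addrC addKr nrm_rs gtr0_norm.
Qed.

Lemma condexp_le a p : a <=p p -> E a <=p E p.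
Proof. by move=> /condexp_pos; rewrite /leA linearB. Qed.

(** For selfadjoint p the element ||p|| - p is positive, so its image is selfadjoint and hence so is
    E[p]; real and imaginary parts give the general case. *)
Lemma condexp_star a : E (star a) = star (E a).
Proof.
have sa_case p : star p = p -> star (E p) = E p.
  move=> sp; have /condexp_pos[] := sa_le_nrm sp.
  by rewrite linearB condexp_rs starB star_rs => /addrI/oppr_inj.
have s1 : star (a + star a) = a + star a by rewrite starD starK addrC.
have h : a = 2^-1 *:c (a + star a) + 'i *: cIm a.
  have i0 : 'i != 0 :> R[i] by rewrite neq0Ci.
  rewrite /cIm; nc_ring.
move: (cIm a) (star_cIm a) h => k sk h.
rewrite [in RHS]h linearD /= !linearZ /= starD starZr starZi.
rewrite (sa_case _ s1) (sa_case _ sk).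
rewrite -!linearZ -linearD /=; congr (E _).
rewrite {1}h starD starZr starZi sk s1.
by [].
Qed.

Lemma condexp_cIm a : E (cIm a) = cIm (E a).
Proof. by rewrite /cIm linearZ /= linearB condexp_star. Qed.

Lemma condexpMl b a : E (incl b * a) = b * E a.
Proof. by rewrite -[incl b * a]mulr1 -(rmorph1 incl) (condexp_bimodule hE) mulr1. Qed.

Lemma condexpMr a b : E (a * incl b) = E a * b.
Proof.
by rewrite -[a * _]mul1r mulrA -(rmorph1 incl) (condexp_bimodule hE) mul1r.
Qed.

(** Positivity of E on the square of a - E[a]; the bimodule property evaluates the cross terms. *)
Lemma condexp_schwarz a : star (E a) * E a <=p E (star a * a).
Proof.
have := nonneg_pos (condexp_nonneg (a - incl (E a))).
rewrite starB -(incl_star hE) mulrBr !mulrBl !linearB /= !condexpMl condexpMr.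
rewrite condexp_star (condexp_id hE).
by rewrite subrr addr0.
Qed.

Lemma nrm_condexp a : nrm (E a) <= nrm a.
Proof.
rewrite -ler_sqr ?nnegrE ?nrm_ge0 // -nrm_cstar.
apply: pos_nrm; [exact: sqr_ge0 | exact: pos_starM |].
apply: leA_trans (condexp_schwarz a) _.
by rewrite -condexp_rs; apply/condexp_le/starM_le.
Qed.

(* The positivity of [E (t* t)] for [t = p* (S^-1 m) - q]. *)
Lemma condexp_cauchy_schwarz (S : B) p q : spos S -> E (p * star p) <=p S ->
  star (E (p * q)) * S^-1 * E (p * q) <=p E (star q * q).
Proof.
move=> pS hp; set m := E (p * q).
have uS := spos_unit pS; have sS : star S = S by case: pS.
have sSV : star S^-1 = S^-1 by rewrite star_inv // sS.
pose l := S^-1 * m; have sl : star l = star m * S^-1 by rewrite starM sSV.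
have Em : E (star q * star p) = star m by rewrite -starM condexp_star.
have h := nonneg_pos (condexp_nonneg (star p * incl l - q)).
rewrite /leA.
have -> : E (star q * q) - star m * S^-1 * m =
   E (star (star p * incl l - q) * (star p * incl l - q)) +
   star l * (S - E (p * star p)) * l.
  rewrite starB starM starK -(incl_star hE).
  have -> : (incl (star l) * p - star q) * (star p * incl l - q) =
     incl (star l) * (p * star p * incl l) - incl (star l) * (p * q)
     - (star q * star p) * incl l + star q * q by nc_ring.
  rewrite linearD !linearB /= !condexpMl !condexpMr Em -/m.
  have l1 : star l * S * l = star m * S^-1 * m.
    by rewrite sl mulrVK // /l mulrA.
  have l2 : star l * m = star m * S^-1 * m by rewrite sl.
  have l3 : star m * l = star m * S^-1 * m by rewrite mulrA.
  rewrite mulrBr mulrBl l1 l2 l3.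
  by nc_ring.
by apply: posD => //; apply: pos_conj.
Qed.


(** The a and a' of the overview; L or R records the side of F, which matters since B need not
    commute with the resolvent. *)
Definition fluctL (x : M) (w : B) : M :=
  incl (Ftr incl E x w) * (incl w - x)^-1 - 1.
Definition fluctR (x : M) (w : B) : M :=
  (incl w - x)^-1 * incl (Ftr incl E x w) - 1.

(** Centring subtracts exactly z, which turns formulas for F into formulas for h = F - w. *)
Lemma condexp_center p q z : E p = 1 -> E q = 1 ->
  E ((p - 1) * incl z * (q - 1)) = E (p * incl z * q) - z.
Proof.
move=> hp hq.
rewrite mulrBr mulr1 !mulrBl mul1r !linearB /= !condexpMl !condexpMr.
by rewrite hp hq (condexp_id hE) mul1r mulr1 subrr addr0.
Qed.

Section Resolvent.
Variable x : M.
Hypothesis hx : star x = x.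
Variables (w : B) (e : R).
Hypothesis e0 : 0 < e.
Hypothesis hw : e *:c 1 <=p cIm w.

Local Notation X := (incl w - x).
Local Notation r := ((incl w - x)^-1).
Local Notation G := (Gtr incl E x w).
Local Notation F := (Ftr incl E x w).
Local Notation h := (htr incl E x w).

Lemma cIm_sub_sa : cIm X = incl (cIm w).
Proof. by rewrite cImB (cIm_sa hx) subr0 cIm_incl. Qed.

Lemma resolvent_dissipative : e *:c 1 <=p cIm X.
Proof. by rewrite cIm_sub_sa -incl_rs; apply: incl_le. Qed.

Lemma resolvent_unit : X \is a GRing.unit.
Proof. exact: dissipative_unit e0 resolvent_dissipative. Qed.

Lemma nrm_resolvent : nrm r <= e^-1.
Proof. exact: dissipative_inv e0 resolvent_dissipative. Qed.

Lemma cIm_resolvent : r * incl (cIm w) * star r = - cIm r /\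
  star r * incl (cIm w) * r = - cIm r.
Proof.
by have [h1 h2] := cIm_inv resolvent_unit; rewrite cIm_sub_sa in h1 h2;
  rewrite {1}h1 h2 !opprK.
Qed.

(** Here -Im G = E[star r (Im w) r] >= e E[star r r], and star r r is bounded below because r has
    the inverse X; the 1 added to ||X|| guards the division. This makes G invertible, so that [Ftr]
    is a genuine inverse. *)
Lemma Gtr_dissipative : exists2 d : R, 0 < d & d *:c 1 <=p cIm (- G).
Proof.
have k0 : 0 < nrm X + 1 by rewrite ltr_wpDl ?nrm_ge0.
exists (e / (nrm X + 1) ^+ 2); first by rewrite divr_gt0 // exprn_gt0.
rewrite cImN /Gtr -condexp_cIm -linearN /= -condexp_rs; apply: condexp_le.
rewrite -cIm_resolvent.2 -cIm_sub_sa.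
apply: leA_trans (leA_conj r resolvent_dissipative).
have -> : star r * (e *:c 1) * r = e *:c (star r * r).
  by rewrite -scalerAr -scalerAl mulr1.
have -> : e *:c (star r * r) =
    (e / (nrm X + 1) ^+ 2) *:c ((nrm X + 1) ^+ 2 *:c (star r * r)).
  by rewrite scalerA -rmorphM divfK // lt0r_neq0 // exprn_gt0.
apply: leAZ; first by rewrite divr_ge0 ?sqr_ge0 ?ltW.
have := leA_conj r (starM_le (c := X) (r := nrm X + 1) _).
rewrite -scalerAr -scalerAl mulr1 mulrA -mulrA mulrV ?resolvent_unit //.
rewrite mulr1 -starM mulrV ?resolvent_unit // star1; apply.
by rewrite lerDl.
Qed.

Lemma Gtr_unit : G \is a GRing.unit.
Proof.
by have [d d0 /(dissipative_unit d0)] := Gtr_dissipative; rewrite unitrN.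
Qed.

Lemma FtrK : F * G = 1.
Proof. by rewrite mulVr // Gtr_unit. Qed.

Lemma GtrK : G * F = 1.
Proof. by rewrite mulrV // Gtr_unit. Qed.

Lemma condexp_Fr : E (incl F * r) = 1.
Proof. by rewrite condexpMl FtrK. Qed.

Lemma condexp_rF : E (r * incl F) = 1.
Proof. by rewrite condexpMr GtrK. Qed.

Lemma condexp_fluctL : E (fluctL x w) = 0.
Proof. by rewrite linearB condexp_Fr (condexp_unit hE) subrr. Qed.

(** The formula for Im a^-1 is used for r = X^-1 and again for F = G^-1; its two orders of factors
    produce the two fluctuations. *)
Lemma cIm_htr :
  E (fluctL x w * incl (cIm w) * star (fluctL x w)) = cIm h /\
  E (star (fluctR x w) * incl (cIm w) * fluctR x w) = cIm h.
Proof.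
have [h1 h2] := cIm_resolvent; have [f1 f2] := cIm_inv Gtr_unit.
have EG : E (cIm r) = cIm G by rewrite condexp_cIm.
have s1 : E (star (incl F * r)) = 1 by rewrite condexp_star condexp_Fr star1.
have s2 : E (star (r * incl F)) = 1 by rewrite condexp_star condexp_rF star1.
rewrite /fluctL /fluctR !starB !star1 /htr cImB; split.
  rewrite condexp_center ?condexp_Fr //; congr (_ - _).
  rewrite starM -(incl_star hE).
  have -> : incl F * r * incl (cIm w) * (star r * incl (star F)) =
    incl F * (r * incl (cIm w) * star r * incl (star F)) by rewrite !mulrA.
  by rewrite condexpMl condexpMr h1 linearN /= EG f1 mulNr mulrN mulrA.
rewrite condexp_center ?condexp_rF //; congr (_ - _).
rewrite starM -(incl_star hE).
have -> : incl (star F) * star r * incl (cIm w) * (r * incl F) =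
  incl (star F) * (star r * incl (cIm w) * r * incl F) by rewrite !mulrA.
by rewrite condexpMl condexpMr h2 linearN /= EG f2 mulNr mulrN mulrA.
Qed.

Lemma cIm_htr_nonneg : nonneg (cIm h).
Proof.
have [s [ss s2 _ _]] := spos_sqrt (spos_ge e0 hw).
rewrite -cIm_htr.2 -s2 rmorphM /=.
have -> : star (fluctR x w) * (incl s * incl s) * fluctR x w =
    star (incl s * fluctR x w) * (incl s * fluctR x w).
  by rewrite starM -(incl_star hE) ss !mulrA.
exact: condexp_nonneg.
Qed.

(** The element k = h + E[x] equals -E[x a'] and has the imaginary part of h, E[x] being
    selfadjoint. Schwarz gives star k k <= E[star a' x^2 a'] <= (||x||^2 / e) Im k, so ||k||^2 <=
    (||x||^2 / e) ||k||. *)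
Lemma nrm_htr : nrm h <= nrm x + nrm x ^+ 2 / e.
Proof.
have Exr : E (x * r) = w * G - 1.
  have -> : x * r = incl w * r - X * r by rewrite mulrBl subKr.
  by rewrite mulrV ?resolvent_unit // linearB /= condexpMl (condexp_unit hE).
have hk : h + E x = - E (x * fluctR x w).
  rewrite /fluctR mulrBr mulr1 mulrA linearB /= condexpMr Exr mulrBl mul1r.
  by rewrite -mulrA GtrK mulr1 /htr; nc_ring.
set k := h + E x in hk.
have Imk : cIm k = cIm h.
  by rewrite cImD [cIm (E x)]cIm_sa ?addr0 // -condexp_star hx.
have n0 : 0 <= nrm x ^+ 2 / e by rewrite divr_ge0 ?sqr_ge0 // ltW.
have k2 : nrm k ^+ 2 <= nrm x ^+ 2 / e * nrm k.
  rewrite -nrm_cstar; apply: pos_nrm; last 1 first.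
  - have -> : star k * k = star (E (x * fluctR x w)) * E (x * fluctR x w).
      by rewrite hk starN mulrNN.
    apply: leA_trans (condexp_schwarz _) _.
    apply: (@leA_trans _ _ _ ((nrm x ^+ 2 / e) *:c cIm h)).
      rewrite -cIm_htr.2 -linearZ; apply: condexp_le.
      have -> : star (x * fluctR x w) * (x * fluctR x w) =
        star (fluctR x w) * (star x * x) * fluctR x w.
        by rewrite starM !mulrA.
      rewrite scalerAl scalerAr; apply: leA_conj.
      apply: leA_trans (starM_le (lexx _)) _.
      rewrite -{1}(divfK (lt0r_neq0 e0) (nrm x ^+ 2)) rmorphM -scalerA.
      by apply: leAZ => //; rewrite -incl_rs; apply: incl_le.
    have -> : (nrm x ^+ 2 / e * nrm k) *:c (1 : B) =
        (nrm x ^+ 2 / e) *:c (nrm k *:c 1) by rewrite scalerA -rmorphM.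
    apply: leAZ => //.
    apply: leA_trans (sa_le_nrm (star_cIm _)) _; apply: leA_rs.
    by rewrite -Imk nrm_cIm.
  - by rewrite mulr_ge0 ?nrm_ge0.
  - exact: pos_starM.
have k1 : nrm k <= nrm x ^+ 2 / e.
  have [->|kn] := eqVneq (nrm k) 0; first by [].
  by rewrite -(ler_pM2r (x := nrm k)) -?expr2 // lt_def kn nrm_ge0.
have -> : h = k - E x by rewrite addrK.
apply: le_trans (nrmB _ _) _; rewrite addrC; apply: lerD => //.
exact: nrm_condexp.
Qed.

Lemma nrm_Ftr : nrm F <= nrm w + (nrm x + nrm x ^+ 2 / e).
Proof.
rewrite -[F](subrK w) addrC; apply: le_trans (nrmD _ _) _.
by rewrite lerD2l nrm_htr.
Qed.

End Resolvent.

(** The resolvent identity r (w - w') r' = r' - r, multiplied by F and F' and averaged, collapses to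
    F - F' because F G = 1 = G' F'. *)
Lemma htr_diff x w w' e e' : star x = x -> 0 < e -> 0 < e' ->
  e *:c 1 <=p cIm w -> e' *:c 1 <=p cIm w' ->
  htr incl E x w - htr incl E x w' =
    E (fluctL x w * incl (w - w') * fluctR x w').
Proof.
move=> hx e0 e0' hw hw'.
rewrite /fluctL /fluctR condexp_center ?(condexp_Fr _ e0) ?(condexp_rF _ e0') //.
set F := Ftr _ _ _ w; set F' := Ftr _ _ _ w'.
set r := (incl w - x)^-1; set r' := (incl w' - x)^-1.
have -> : incl F * r * incl (w - w') * (r' * incl F') =
    incl F * (r' - r) * incl F'.
  have -> : incl (w - w') = (incl w - x) - (incl w' - x).
    by rewrite rmorphB /=; nc_ring.
  rewrite -!mulrA; congr (_ * _); rewrite !mulrA; congr (_ * _).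
  rewrite mulrBr mulrBl mulVr ?(resolvent_unit hx e0) // mul1r.
  by rewrite mulrK ?(resolvent_unit hx e0').
have -> : E (incl F * (r' - r) * incl F') =
    F * (Gtr incl E x w' * F') - F * Gtr incl E x w * F'.
  by rewrite condexpMr condexpMl linearB; nc_ring.
rewrite (GtrK hx e0' hw') mulr1 (FtrK hx e0 hw) mul1r.
by rewrite /htr; nc_ring.
Qed.

(* [z* (Im w)^-1 z <= k Im w'] reads
   [|| (Im w)^(-1/2) z (Im w')^(-1/2) ||^2 <= k]; for [z = w - w'] the left-hand
   side is a Poincare-type pseudo-distance that replaces the Caratheodory metric
   of the Earle-Hamilton theorem. *)
Definition hyp_le (k : R) (w w' z : B) :=
  star z * (cIm w)^-1 * z <=p k *:c cIm w'.

(** With s the root of Im w, split a z a' into p = a s and q = s^-1 z a'. Cauchy-Schwarz with S = t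
    c applies since E[p star p] = Im h_x(w), and star q q reproduces the hypothesis on z. The vector
    z is free so that linearized maps are covered too. *)
Lemma htr_contraction x w w' z c (e e' k t : R) : star x = x ->
  0 < e -> 0 < e' -> e *:c 1 <=p cIm w -> e' *:c 1 <=p cIm w' ->
  0 <= k -> 0 < t -> spos c -> cIm (htr incl E x w) <=p t *:c c ->
  hyp_le k w w' z ->
  let m := E (fluctL x w * incl z * fluctR x w') in
  star m * c^-1 * m <=p (t * k) *:c cIm (htr incl E x w').
Proof.
move=> hx e0 e0' hw hw' k0 t0 pc hc hz m.
have [s [ss s2 ps _]] := spos_sqrt (spos_ge e0 hw); have us := spos_unit ps.
have cS : spos (t *:c c) by apply: sposZ.
have tn : t%:C%C != 0 :> R[i].
  by rewrite (fmorph_eq0 (real_complex R)) gt_eqF.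
pose p := fluctL x w * incl s; pose q := incl (s^-1 * z) * fluctR x w'.
have pq : p * q = fluctL x w * incl z * fluctR x w'.
  have si : incl s * incl s^-1 = 1 by rewrite -rmorphM mulrV // rmorph1.
  rewrite /p /q rmorphM /=.
  by rewrite -!mulrA [incl s * _]mulrA si mul1r.
have pp : E (p * star p) <=p t *:c c.
  have -> : p * star p = fluctL x w * incl (s * s) * star (fluctL x w).
    by rewrite /p starM -(incl_star hE) ss rmorphM !mulrA.
  rewrite s2.
  by rewrite (cIm_htr hx e0 hw).1.
have := condexp_cauchy_schwarz q cS pp; rewrite pq -/m => h1.
have h2 : E (star q * q) <=p k *:c cIm (htr incl E x w').
  rewrite -(cIm_htr hx e0' hw').2 -linearZ; apply: condexp_le.
  rewrite scalerAl scalerAr -linearZ.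
  have -> : star q * q = star (fluctR x w') *
      incl (star z * (cIm w)^-1 * z) * fluctR x w'.
    rewrite /q starM -(incl_star hE) starM star_inv // ss -s2 invrM //.
    by rewrite !rmorphM !mulrA.
  by apply: leA_conj; apply: incl_le.
have := leAZ (ltW t0) (leA_trans h1 h2).
rewrite invrZ ?unitfE ?(spos_unit pc) // -scalerAr -scalerAl !scalerA mulfV //.
by rewrite scale1r -rmorphM.
Qed.

End ConditionalExpectation.

(** * Fixed points *)

Section HypNorm.
Context {R : realType} {B : cstar_alg R}.
Implicit Types (a b w z : B) (e k t L : R).

Lemma spos_inv_sandwich a t : spos a ->
  (t *:c 1 <=p a -> t *:c a^-1 <=p 1) /\
  (a <=p t *:c 1 -> 1 <=p t *:c a^-1).
Proof.
move=> pa; have [s [ss s2 ps _]] := spos_sqrt pa; have us := spos_unit ps.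
have sV : star s^-1 = s^-1 by rewrite star_inv // ss.
have e1 : star s^-1 * (t *:c 1) * s^-1 = t *:c a^-1.
  by rewrite sV -scalerAr -scalerAl mulr1 -invrM // s2.
have e2 : star s^-1 * a * s^-1 = 1 by rewrite sV -s2 mulrA mulVr // mul1r mulrV.
by split=> /(leA_conj s^-1); rewrite e1 e2.
Qed.

Lemma hyp_le_nrm w w' z e : 0 < e -> e *:c 1 <=p cIm w ->
  e *:c 1 <=p cIm w' -> hyp_le ((nrm z / e) ^+ 2) w w' z.
Proof.
move=> e0 hw hw'; have pw := spos_ge e0 hw.
rewrite /hyp_le -(scale1r (star z * _ * z)).
have -> : 1 = e^-1%:C%C * e%:C%C :> R[i] by rewrite -rmorphM mulVf ?gt_eqF.
rewrite -scalerA.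
have -> : (nrm z / e) ^+ 2 = e^-1 * (nrm z ^+ 2 / e).
  by field; rewrite gt_eqF.
rewrite rmorphM -[X in _ <=p X]scalerA; apply: leAZ.
  by rewrite invr_ge0 ltW.
apply: (@leA_trans _ _ _ (star z * z)).
  have := leA_conj z ((spos_inv_sandwich e pw).1 hw).
  by rewrite mulr1 -scalerAr -scalerAl.
apply: leA_trans (starM_le (lexx _)) _.
have -> : nrm z ^+ 2 *:c 1 = (nrm z ^+ 2 / e) *:c (e *:c (1 : B)).
  by rewrite scalerA -rmorphM divfK ?gt_eqF.
by apply: leAZ => //; rewrite divr_ge0 ?sqr_ge0 ?ltW.
Qed.

(** The factor L^2 comes from (Im w)^-1 >= 1 / L and Im w' <= L. *)
Lemma nrm_hyp_le w w' z e k L : 0 < e -> e *:c 1 <=p cIm w ->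
  0 <= k -> 0 < L -> nrm w <= L -> nrm w' <= L -> hyp_le k w w' z ->
  nrm z ^+ 2 <= L ^+ 2 * k.
Proof.
move=> e0 hw k0 L0 wL wL' hz; have pw := spos_ge e0 hw.
have imL (v : B) : nrm v <= L -> cIm v <=p L *:c 1.
  move=> vL; apply: leA_trans (sa_le_nrm (star_cIm v)) _.
  by apply: leA_rs; apply: le_trans (nrm_cIm v) _.
rewrite -nrm_cstar; apply: pos_nrm; last 1 first.
- apply: (@leA_trans _ _ _ (L *:c (star z * (cIm w)^-1 * z))).
    have := leA_conj z ((spos_inv_sandwich L pw).2 (imL _ wL)).
    by rewrite mulr1 -scalerAr -scalerAl.
  have -> : (L ^+ 2 * k) *:c 1 = L *:c (k *:c (L *:c (1 : B))).
    by rewrite !scalerA -!rmorphM; congr (_%:C%C *: _); ring.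
  apply: leAZ; first exact: ltW.
  by apply: leA_trans hz _; apply: leAZ => //; apply: imL.
- by rewrite mulr_ge0 ?sqr_ge0.
- exact: pos_starM.
Qed.

Lemma hyp_leW k k' w w' z : k <= k' -> pos (cIm w') ->
  hyp_le k w w' z -> hyp_le k' w w' z.
Proof.
move=> kk pw /leA_trans; apply; rewrite /leA -scalerBl -rmorphB.
by apply: posZ; rewrite // subr_ge0.
Qed.

(** The norm is exchanged for the pseudo-distance at stage 0 (cost 1 / e) and back at stage n (cost
    L), so norm bounds are asked at stage n and the start may have any size. The vectors [z] will be
    differences of orbits, or iterates of a linear map. *)
Lemma hyp_iter_nrm (u u' z : nat -> B) e L (q : R) : 0 < e -> 0 < L -> 0 <= q ->
  (forall n, e *:c 1 <=p cIm (u n)) -> (forall n, e *:c 1 <=p cIm (u' n)) ->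
  (forall n k, 0 <= k -> hyp_le k (u n) (u' n) (z n) ->
     hyp_le (q ^+ 2 * k) (u n.+1) (u' n.+1) (z n.+1)) ->
  forall n, nrm (u n) <= L -> nrm (u' n) <= L ->
  nrm (z n) <= L / e * q ^+ n * nrm (z 0%N).
Proof.
move=> e0 L0 q0 hu hu' hz n uL uL'.
pose k m := (q ^+ m * (nrm (z 0%N) / e)) ^+ 2.
have km0 m : 0 <= k m by rewrite sqr_ge0.
have hk m : hyp_le (k m) (u m) (u' m) (z m).
  elim: m => [|m IH]; first by rewrite /k expr0 mul1r; apply: hyp_le_nrm.
  have -> : k m.+1 = q ^+ 2 * k m by rewrite /k [q ^+ m.+1]exprS; ring.
  exact: hz.
have := nrm_hyp_le e0 (hu n) (km0 n) L0 uL uL' (hk n).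
rewrite /k -exprMn ler_sqr ?nnegrE ?nrm_ge0 //; last first.
  by rewrite !mulr_ge0 ?exprn_ge0 ?nrm_ge0 ?invr_ge0 // ltW.
by move/le_trans; apply; rewrite le_eqVlt; apply/orP; left; apply/eqP; ring.
Qed.

Lemma cIm_ge_limit w e : (forall d, 0 < d ->
    exists2 u, e *:c 1 <=p cIm u & nrm (u - w) <= d) ->
  e *:c 1 <=p cIm w.
Proof.
move=> h; apply: pos_limit => d d0; have [u hu uw] := h d d0.
exists (cIm u - e *:c 1) => //.
have -> : cIm u - e *:c 1 - (cIm w - e *:c 1) = cIm (u - w).
  by rewrite cImB; nc_ring.
exact: le_trans (nrm_cIm _) uw.
Qed.

Lemma cvg_nrm (u : nat -> B) (l : B) :
  (forall e : R, 0 < e -> exists N, forall n, (N <= n)%N -> nrm (u n - l) < e) ->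
  u @ \oo --> l.
Proof.
move=> h; apply/cvgrPdist_lt => e; rewrite ltcE => /andP[/eqP/= Ie e0].
have [N hN] := h _ e0; exists N => // n /= Nn.
by rewrite nrmE ltcE /= Ie eqxx /= nrm_distC hN.
Qed.

(** Since C may exceed 1, [f] itself need not contract the norm. The orbit of [w0] is Cauchy by
    comparison with the orbit of [f w0]. *)
Lemma iter_contraction_fixpoint (f : B -> B) (D : B -> Prop) (C q : R) w0 :
  0 <= q -> q < 1 -> 0 <= C -> D w0 -> (forall w, D w -> D (f w)) ->
  (forall l, (forall e : R, 0 < e -> exists2 u, D u & nrm (u - l) <= e) -> D l) ->
  (forall w w' n, D w -> D w' ->
     nrm (iter n.+1 f w - iter n.+1 f w') <= C * q ^+ n * nrm (w - w')) ->
  exists c, [/\ D c, f c = c & forall w n, D w ->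
    nrm (iter n.+1 f w - c) <= C * nrm (w - c) * q ^+ n].
Proof.
move=> q0 q1 C0 D0 fD Dc hf.
pose u n := iter n.+1 f w0.
have Dit n w : D w -> D (iter n f w) by elim: n => //= n IH /IH /fD.
have du n : nrm (u n.+1 - u n) <= C * nrm (f w0 - w0) * q ^+ n.
  by rewrite /u iterSr mulrAC; apply: hf => //; apply: fD.
have [c hc] := geom_cvg q0 q1 (mulr_ge0 C0 (nrm_ge0 _)) du.
set C' := _ / _ in hc.
have DC : D c.
  apply: Dc => e e0; have [N hN] := geom_lt C' q0 q1 e0.
  exists (u N); first exact: Dit.
  exact: le_trans (hc N) (ltW (hN _ (leqnn N))).
have fc : f c = c.
  apply/subr0_eq/(nrm_small (C := (C + 1) * C') q0 q1) => n.
  apply: le_trans (nrm_dist _ (u n.+1) _) _.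
  have h1 : nrm (f c - u n.+1) <= C * nrm (u n - c).
    rewrite nrm_distC; have := hf (u n) c 0%N (Dit _ _ D0) DC.
    by rewrite expr0 mulr1.
  have h2 : C * nrm (u n - c) <= C * (C' * q ^+ n) by rewrite ler_wpM2l.
  have h3 : nrm (u n.+1 - c) <= C' * q ^+ n.
    apply: le_trans (hc _) _; rewrite exprS ler_wpM2l //.
      by rewrite /C' divr_ge0 ?mulr_ge0 ?nrm_ge0 // subr_ge0 ltW.
    by rewrite ler_piMl ?exprn_ge0 // ltW.
  by lra.
exists c; split=> // w n Dw.
have fcn m : iter m f c = c by elim: m => //= m ->.
by rewrite -{1}(fcn n.+1) mulrAC; apply: hf.
Qed.

End HypNorm.

Section FixedPoint.
Context {R : realType} {M B : cstar_alg R}.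
Variables (incl : {lrmorphism B -> M}) (E : {linear M -> B}).
Hypothesis hE : opv_prob_space incl E.
Implicit Types (x y : M) (b w z : B) (e k t K L : R).

Local Notation h := (htr incl E).
Local Notation slope x w w' z :=
  (E (fluctL incl E x w * incl z * fluctR incl E x w')).

Definition hbound x e : R := nrm x + nrm x ^+ 2 / e + 1.

Lemma hbound_gt0 x e : 0 < e -> 0 < hbound x e.
Proof.
move=> e0; rewrite ltr_wpDl // addr_ge0 ?nrm_ge0 // divr_ge0 ?sqr_ge0 //.
exact: ltW.
Qed.

Lemma nrm_htr_bound x w e : star x = x -> 0 < e -> e *:c 1 <=p cIm w ->
  nrm (h x w) <= hbound x e.
Proof.
move=> hx e0 hw; apply: le_trans (nrm_htr hE hx e0 hw) _.
by rewrite lerDl.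
Qed.

(** With K = [hbound x e], the smallest t such that s <= t (s + e) for all s in [0, K]; applied to
    Im h <= K and Im b >= e, it makes the shift by b a strict gain. *)
Definition rate x e : R := hbound x e / (hbound x e + e).

Lemma rate_bounds x e : 0 < e -> 0 < rate x e < 1.
Proof.
move=> e0; have K0 := hbound_gt0 x e0.
have Ke : 0 < hbound x e + e by rewrite addr_gt0.
by rewrite /rate divr_gt0 //= ltr_pdivrMr // mul1r ltrDl.
Qed.

Lemma rate_mul_le x y e k : 0 < e -> 0 <= k ->
  rate y e * (rate x e * k) <= Num.max (rate x e) (rate y e) ^+ 2 * k.
Proof.
move=> e0 k0; have [tx0 _] := andP (rate_bounds x e0).
have [ty0 _] := andP (rate_bounds y e0).
rewrite expr2 mulrA ler_wpM2r //; apply: ler_pM; try exact: ltW;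
by rewrite le_max lexx ?orbT.
Qed.

Lemma step_region x b w e : star x = x -> 0 < e -> e *:c 1 <=p cIm w ->
  cIm b <=p cIm (h x w + b).
Proof.
move=> hx e0 hw; rewrite /leA cImD addrK; apply: nonneg_pos.
exact: (cIm_htr_nonneg hE hx e0 hw).
Qed.

(** One half of [fixmap]. The strict gain is taken on the side of w; on that of w' the term Im b' >=
    0 is simply added. The parameters may differ because fixed points at nearby b are compared
    later. *)
Lemma step_contraction x b b' w w' z e k : star x = x -> 0 < e -> 0 <= k ->
  e *:c 1 <=p cIm b -> e *:c 1 <=p cIm b' ->
  e *:c 1 <=p cIm w -> e *:c 1 <=p cIm w' ->
  hyp_le k w w' z ->
  hyp_le (rate x e * k) (h x w + b) (h x w' + b') (slope x w w' z).
Proof.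
move=> hx e0 k0 hb hb' hw hw' hz.
have [t0 t1] := andP (rate_bounds x e0); set t := rate x e in t0 t1 *.
have K0 := hbound_gt0 x e0.
have pc : spos (cIm (h x w + b)).
  exact/(spos_ge e0)/(leA_trans hb)/(step_region _ hx e0 hw).
have hc : cIm (h x w) <=p t *:c cIm (h x w + b).
  have tK : (1 - t) * hbound x e = t * e.
    by rewrite /t /rate; field; rewrite gt_eqF // addr_gt0.
  rewrite /leA cImD.
  have -> : t *:c (cIm (h x w) + cIm b) - cIm (h x w) =
     t *:c (cIm b - e *:c 1) +
     (1 - t) *:c (hbound x e *:c 1 - cIm (h x w)).
    have -> : (1 - t) *:c (hbound x e *:c 1 - cIm (h x w)) =
       (t * e) *:c 1 - (1 - t) *:c cIm (h x w).
      by rewrite -tK; nc_ring.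
    by nc_ring.
  apply: posD; first by apply: posZ => //; exact: ltW.
  apply: posZ; first by rewrite subr_ge0 ltW.
  apply: pos_sub_rs; first exact: star_cIm.
  by apply: le_trans (nrm_cIm _) _; apply: nrm_htr_bound.
have := htr_contraction hE hx e0 e0 hw hw' k0 t0 pc hc hz.
move=> h1; apply: leA_trans h1 _; apply: leAZ.
  by rewrite mulr_ge0 // ltW.
rewrite /leA cImD addrC addKr; apply: pos_le hb'.
exact/pos_rs/ltW.
Qed.

Lemma step_diff x b w w' e : star x = x -> 0 < e ->
  e *:c 1 <=p cIm w -> e *:c 1 <=p cIm w' ->
  (h x w + b) - (h x w' + b) = slope x w w' (w - w').
Proof.
move=> hx e0 hw hw'; rewrite -(htr_diff hE hx e0 e0 hw hw').
by nc_ring.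
Qed.

Section Iterates.
Variables (x y : M) (b : B) (e : R).
Hypotheses (hx : star x = x) (hy : star y = y).
Hypotheses (e0 : 0 < e) (hb : e *:c 1 <=p cIm b).
Local Notation f := (fixmap incl E x y b).

Lemma fixmap_region w (e' : R) : 0 < e' -> e' *:c 1 <=p cIm w ->
  cIm b <=p cIm (f w).
Proof.
move=> e0' hw; have h1 := step_region b hx e0' hw.
exact: (step_region _ hy e0 (leA_trans hb h1)).
Qed.

Lemma fixmap_ge w : e *:c 1 <=p cIm w -> e *:c 1 <=p cIm (f w).
Proof. by move=> hw; apply: (leA_trans hb); apply: fixmap_region hw. Qed.

Lemma fixmap_iter_ge w n : e *:c 1 <=p cIm w -> e *:c 1 <=p cIm (iter n f w).
Proof. by move=> hw; elim: n => //= n /fixmap_ge. Qed.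

Lemma nrm_fixmap w : e *:c 1 <=p cIm w -> nrm (f w) <= hbound y e + nrm b.
Proof.
move=> hw; apply: le_trans (nrmD _ _) _; rewrite lerD2r.
apply: nrm_htr_bound => //; apply: leA_trans hb _; exact: step_region hw.
Qed.

Lemma fixmap_contraction w w' k : 0 <= k ->
  e *:c 1 <=p cIm w -> e *:c 1 <=p cIm w' -> hyp_le k w w' (w - w') ->
  hyp_le (rate y e * (rate x e * k)) (f w) (f w') (f w - f w').
Proof.
move=> k0 hw hw' hz.
have h1 := leA_trans hb (step_region b hx e0 hw).
have h1' := leA_trans hb (step_region b hx e0 hw').
rewrite /fixmap (step_diff b hy e0 h1 h1').
have [t0 _] := andP (rate_bounds x e0).
apply: step_contraction => //; first by rewrite mulr_ge0 // ltW.
by rewrite (step_diff b hx e0 hw hw'); apply: step_contraction.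
Qed.

(** Each application gains q^2 in the pseudo-distance, which is quadratic, hence q in norm. From the
    first iterate on the norms are at most L, whatever the start; one of the n + 1 factors q is
    given away. *)
Lemma nrm_iter_fixmap w w' n : e *:c 1 <=p cIm w -> e *:c 1 <=p cIm w' ->
  nrm (iter n.+1 f w - iter n.+1 f w') <=
  (hbound y e + nrm b) / e * Num.max (rate x e) (rate y e) ^+ n * nrm (w - w').
Proof.
move=> hw hw'; set L := hbound y e + nrm b; set q := Num.max _ _.
have L0 : 0 < L by rewrite ltr_pwDl ?nrm_ge0 // hbound_gt0.
have [tx0 tx1] := andP (rate_bounds x e0).
have [ty0 ty1] := andP (rate_bounds y e0).
have q0 : 0 <= q by rewrite le_max ltW.
have q1 : q <= 1 by rewrite ge_max !ltW.
have hz m k : 0 <= k ->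
    hyp_le k (iter m f w) (iter m f w') (iter m f w - iter m f w') ->
    hyp_le (q ^+ 2 * k) (iter m.+1 f w) (iter m.+1 f w')
      (iter m.+1 f w - iter m.+1 f w').
  move=> k0 /(fixmap_contraction k0 (fixmap_iter_ge m hw) (fixmap_iter_ge m hw')).
  apply: hyp_leW; first exact: rate_mul_le.
  by apply: pos_le (fixmap_iter_ge m.+1 hw'); exact/pos_rs/ltW.
have := hyp_iter_nrm (z := fun m => iter m f w - iter m f w')
  e0 L0 q0 (fun m => fixmap_iter_ge m hw)
  (fun m => fixmap_iter_ge m hw') hz (n := n.+1)
  (nrm_fixmap (fixmap_iter_ge n hw)) (nrm_fixmap (fixmap_iter_ge n hw')).
move/le_trans; apply; rewrite ler_wpM2r ?nrm_ge0 //.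
have C0 : 0 <= L / e by rewrite divr_ge0 // ltW.
by rewrite ler_wpM2l // exprS ler_piMl // exprn_ge0.
Qed.

End Iterates.

Lemma upper_half_planeP b :
  upper_half_plane b <-> exists2 e : R, 0 < e & e *:c 1 <=p cIm b.
Proof. exact: strictly_posP. Qed.

Lemma fixmap_attracting x y b : star x = x -> star y = y ->
  upper_half_plane b ->
  exists c, attracting_unique_fixpoint (fixmap incl E x y b) c.
Proof.
move=> hx hy /upper_half_planeP[e e0 hb].
pose f := fixmap incl E x y b.
(* One step carries the whole half-plane into the closed set where Im >= e, so uniqueness and
   attraction reduce to that set. *)
have fH w : upper_half_plane w -> e *:c 1 <=p cIm (f w).
  move=> /upper_half_planeP[e' e0' hw].
  exact: leA_trans hb (fixmap_region hx hy e0 hb e0' hw).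
have [tx0 tx1] := andP (rate_bounds x e0).
have [ty0 ty1] := andP (rate_bounds y e0).
set q := Num.max (rate x e) (rate y e).
have q0 : 0 <= q by rewrite le_max ltW.
have q1 : q < 1 by rewrite gt_max tx1.
have C0 : 0 <= (hbound y e + nrm b) / e.
  rewrite divr_ge0 ?(ltW e0) // addr_ge0 ?nrm_ge0 //.
  exact/ltW/hbound_gt0.
have [c [Dc fc hc]] := iter_contraction_fixpoint
  (D := fun w => e *:c 1 <=p cIm w) q0 q1 C0 hb
  (fun w => fixmap_ge hx hy e0 hb (w := w)) (fun w => cIm_ge_limit (e := e))
  (fun w w' n => nrm_iter_fixmap hx hy e0 hb n (w := w) (w' := w')).
exists c; split.
- by move=> w /fH hw; apply/upper_half_planeP; exists e.
- by split=> //; apply/upper_half_planeP; exists e.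
- move=> w /fH hw fw; rewrite /f fw in hw.
  have it m : iter m (fixmap incl E x y b) w = w by elim: m => //= m ->.
  apply/subr0_eq/(nrm_small q0 q1) => n.
  by have := hc w n hw; rewrite it; exact.
- move=> w /fH hw; apply: cvg_nrm => d d0.
  have [N hN] := geom_lt ((hbound y e + nrm b) / e * nrm (f w - c)) q0 q1 d0.
  (* One step brings w into the region; the other is the index shift in [hc]. *)
  exists N.+2 => -[|[|n]] // Nn; rewrite iterSr.
  exact: (le_lt_trans (hc _ _ hw) (hN _ Nn)).
Qed.

End FixedPoint.

(** * Analytic dependence *)

Section LinearFixedPoint.
Context {R : realType} {B : cstar_alg R}.
Implicit Types (b s t z : B) (C q : R).

(** Linearity of L is over [R[i]], so the derivative is a complex one; its norm bound supplies the
    continuity that [differentiable] asks for. *)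
Lemma differentiable_quadratic (f L : B -> B) b (C D d : R) :
  linear L -> (forall t, nrm (L t) <= C * nrm t) -> 0 <= C -> 0 <= D -> 0 < d ->
  (forall t, nrm t <= d -> nrm (f (t + b) - f b - L t) <= D * nrm t ^+ 2) ->
  differentiable f b.
Proof.
move=> hL LC C0 D0 d0 hf.
pose df : {linear B -> B} := HB.pack L (GRing.isLinear.Build _ _ _ _ L hL).
have dfc : continuous df.
  apply: bounded_linear_continuous; apply/linear_boundedP.
  near=> r => x; rewrite !nrmE.
  have rC : C%:C%C <= r by near: r; apply: nbhs_pinfty_ge; apply/complex_realP; exists C.
  apply: (@le_trans _ _ (C%:C%C * (nrm x)%:C%C)).
    by rewrite -rmorphM lecR; exact: LC.
  by rewrite ler_wpM2r // ler0c nrm_ge0.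
have hdf : f \o shift b = cst (f b) + df +o_ 0 id.
  apply/eqaddoP => eps; rewrite ltcE /= => /andP[/eqP Ie e0].
  have eD0 : 0 < complex.Re eps / (D + 1).
    by rewrite divr_gt0 // ltr_wpDl.
  pose m := Num.min d (complex.Re eps / (D + 1)).
  have m0 : 0 < m by rewrite lt_min d0.
  apply/nbhs_norm0P; exists m%:C%C => /=; first by rewrite ltcR.
  move=> t /=; rewrite nrmE ltcR => tm.
  suff : `|f (t + b) - (f b + L t)| <= eps * (nrm t)%:C%C by [].
  rewrite nrmE.
  have -> : eps = (complex.Re eps)%:C%C by case: (eps) Ie => a c /= ->.
  rewrite -rmorphM lecR.
  have td : nrm t <= d by apply: ltW (lt_le_trans tm _); rewrite ge_min lexx.
  have te : nrm t <= complex.Re eps / (D + 1).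
    by apply: ltW (lt_le_trans tm _); rewrite ge_min lexx orbT.
  have := hf t td; rewrite -[f (t + b) - f b - L t]addrA -opprD => h.
  apply: le_trans h _; rewrite expr2 mulrA ler_wpM2r ?nrm_ge0 //.
  apply: (@le_trans _ _ (D * (complex.Re eps / (D + 1)))); first by rewrite ler_wpM2l.
  rewrite mulrA ler_pdivrMr ?ltr_wpDl // mulrC ler_pM2l //.
  by rewrite lerDl.
have dE := diff_unique dfc hdf.
by apply/diff_locallyP; rewrite dE.
Unshelve. all: by end_near.
Qed.

(** A bound for (1 - S)^-1 when only the powers of S are controlled: z differs from the n-th partial
    sum of the series of S^k s by S^n z. *)
Lemma affine_fixpoint_bound (S : B -> B) C q z s : 0 <= q -> q < 1 -> 0 <= C ->
  {morph S : u v / u + v} ->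
  (forall n v, nrm (iter n S v) <= C * q ^+ n * nrm v) ->
  z = S z + s -> nrm z <= C / (1 - q) * nrm s.
Proof.
move=> q0 q1 C0 SD hS zs.
pose u n := iter n (fun v => S v + s) 0.
have du n : u n.+1 - u n = iter n S s.
  elim: n => [|n IH]; first by rewrite /u /= subr0 -[S 0](addrK (S 0)) -SD addr0 subrr add0r.
  have SB v w : S v - S w = S (v - w).
    by apply/eqP; rewrite subr_eq -SD subrK.
  rewrite /u !iterS -/(u n.+1) -/(u n) opprD addrACA subrr addr0.
  by rewrite SB IH.
have zu n : z - u n = iter n S z.
  elim: n => [|n IH]; first by rewrite subr0.
  have SB v w : S v - S w = S (v - w).
    by apply/eqP; rewrite subr_eq -SD subrK.
  rewrite /u !iterS -/(u n) {1}zs opprD addrACA subrr addr0.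
  by rewrite SB IH.
have du' n : nrm (u n.+1 - u n) <= C * nrm s * q ^+ n.
  by rewrite du mulrAC.
have hs := geom_sum q0 q1 (mulr_ge0 C0 (nrm_ge0 s)) du'.
apply: le_addgt0 => e e0; have [N hN] := geom_lt (C * nrm z) q0 q1 e0.
rewrite -[z](subrK (u N)) addrC; apply: le_trans (nrmD _ _) _; apply: lerD.
  by have := hs N 0%N; rewrite add0n expr0 mulr1 subr0 mulrAC.
rewrite zu; apply: le_trans (hS _ _) _.
by rewrite mulrAC; exact: (ltW (hN _ (leqnn N))).
Qed.

(** V is (1 - S)^-1, built as a Neumann series. Its linearity comes from uniqueness: the defect of
    linearity solves the equation with zero source. *)
Lemma affine_fixpoint (S : B -> B) C q : 0 <= q -> q < 1 -> 0 <= C ->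
  linear S ->
  (forall n v, nrm (iter n S v) <= C * q ^+ n * nrm v) ->
  exists V : B -> B, linear V /\ forall s, V s = S (V s) + s.
Proof.
move=> q0 q1 C0 lS hS.
have SD : {morph S : u v / u + v}.
  by move=> u v; have := lS 1 u v; rewrite !scale1r.
have SB v w : S v - S w = S (v - w).
  by apply/eqP; rewrite subr_eq -SD subrK.
have S0 : S 0 = 0 by have := SB 0 0; rewrite !subrr.
have ex s : exists v, v = S v + s.
  pose u n := iter n (fun v => S v + s) 0.
  have du n : u n.+1 - u n = iter n S s.
    elim: n => [|n IH]; first by rewrite /u /= subr0 S0 add0r.
    rewrite /u !iterS -/(u n.+1) -/(u n) opprD addrACA subrr addr0.
    by rewrite SB IH.
  have du' n : nrm (u n.+1 - u n) <= C * nrm s * q ^+ n.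
    by rewrite du mulrAC.
  have [v hv] := geom_cvg q0 q1 (mulr_ge0 C0 (nrm_ge0 s)) du'.
  set C' := C * nrm s / (1 - q) in hv.
  have C'0 : 0 <= C' by rewrite divr_ge0 ?mulr_ge0 ?nrm_ge0 // subr_ge0 ltW.
  exists v; apply/subr0_eq/(nrm_small (C := (C + 1) * C') q0 q1) => n.
  have -> : v - (S v + s) = S (u n - v) - (u n.+1 - v).
    by rewrite -SB /u iterS -/(u n); nc_ring.
  apply: le_trans (nrmB _ _) _.
  have h1 : nrm (S (u n - v)) <= C * q * nrm (u n - v) by have := hS 1%N (u n - v).
  have h2 : C * q * nrm (u n - v) <= C * (C' * q ^+ n).
    apply: ler_pM; rewrite ?nrm_ge0 ?mulr_ge0 //.
    by apply: ler_piMr => //; exact: ltW.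
  have h3 : nrm (u n.+1 - v) <= C' * q ^+ n.
    apply: le_trans (hv _) _; rewrite exprS ler_wpM2l // ler_piMl ?exprn_ge0 //.
    exact: ltW.
  by lra.
have [V hV] := choice ex; exists V; split=> // a s t.
apply/subr0_eq/nrm_eq0/eqP; rewrite eq_le nrm_ge0 andbT.
have -> : 0 = C / (1 - q) * nrm (0 : B) by rewrite nrm0 mulr0.
apply: (affine_fixpoint_bound (S := S)) => //.
rewrite addr0 -!SB lS {1}(hV (a *: s + t)) {1}(hV s) {1}(hV t).
by nc_ring.
Qed.

End LinearFixedPoint.

Section Analyticity.
Context {R : realType} {M B : cstar_alg R}.
Variables (incl : {lrmorphism B -> M}) (E : {linear M -> B}).
Hypothesis hE : opv_prob_space incl E.
Implicit Types (x y : M) (b w z : B) (e k t K L : R).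

Local Notation h := (htr incl E).
Local Notation slope x w w' z :=
  (E (fluctL incl E x w * incl z * fluctR incl E x w')).

Definition fluct_bound x e L : R := (L + hbound x e) / e + 1.

Lemma nrm_fluct x w e L : star x = x -> 0 < e -> e *:c 1 <=p cIm w ->
  nrm w <= L ->
  nrm (fluctL incl E x w) <= fluct_bound x e L /\
  nrm (fluctR incl E x w) <= fluct_bound x e L.
Proof.
move=> hx e0 hw wL.
have hF : nrm (incl (Ftr incl E x w)) <= L + hbound x e.
  rewrite (nrm_incl hE); apply: le_trans (nrm_Ftr hE hx e0 hw) _.
  by apply: lerD => //; rewrite lerDl.
have hr := nrm_resolvent hE hx e0 hw.
split; apply: le_trans (nrmB _ _) _; rewrite nrm1 lerD2r;
  apply: le_trans (nrmM _ _) _; rewrite 1?[leLHS]mulrC;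
  try (by apply: ler_pM; rewrite ?nrm_ge0);
  by rewrite mulrC; apply: ler_pM; rewrite ?nrm_ge0.
Qed.

Lemma nrm_slope x w w' z e L : star x = x -> 0 < e -> e *:c 1 <=p cIm w ->
  e *:c 1 <=p cIm w' -> nrm w <= L -> nrm w' <= L ->
  nrm (slope x w w' z) <= fluct_bound x e L ^+ 2 * nrm z.
Proof.
move=> hx e0 hw hw' wL wL'; apply: le_trans (nrm_condexp hE _) _.
have [h1 _] := nrm_fluct hx e0 hw wL; have [_ h2] := nrm_fluct hx e0 hw' wL'.
apply: le_trans (nrmM _ _) _.
apply: (@le_trans _ _ (fluct_bound x e L * nrm z * fluct_bound x e L)).
  apply: ler_pM; rewrite ?nrm_ge0 //; apply: le_trans (nrmM _ _) _.
  by rewrite (nrm_incl hE) ler_wpM2r ?nrm_ge0.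
by rewrite mulrAC expr2.
Qed.

Lemma slope_linear x w w' : linear (fun z => slope x w w' z).
Proof.
move=> a u v; set p := fluctL _ _ _ _; set q := fluctR _ _ _ _.
have -> : p * incl (a *: u + v) * q = a *: (p * incl u * q) + p * incl v * q.
  by rewrite linearP; nc_ring.
by rewrite linearP.
Qed.

(** The right base point stays at w0, as in difference quotients taken at a fixed point; the
    estimate reduces to a Lipschitz bound for [fluctL]. *)
Lemma slope_lipschitz x e L : star x = x -> 0 < e -> 0 <= L -> exists2 D, 0 <= D &
  forall w w0 z, e *:c 1 <=p cIm w -> e *:c 1 <=p cIm w0 ->
    nrm w <= L -> nrm w0 <= L ->
    nrm (slope x w w0 z - slope x w0 w0 z) <= D * nrm (w - w0) * nrm z.
Proof.
move=> hx e0 L0; set A := fluct_bound x e L.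
have K0 := hbound_gt0 x e0.
have A0 : 0 <= A.
  by rewrite /A /fluct_bound addr_ge0 // divr_ge0 ?(ltW e0) // addr_ge0 // ltW.
have ei : 0 <= e^-1 by rewrite invr_ge0 ltW.
have D0 : 0 <= (A ^+ 2 + 1) * e^-1 + (L + hbound x e) * (e^-1 * e^-1).
  have LK : 0 <= L + hbound x e by rewrite addr_ge0 // ltW.
  apply: addr_ge0; apply: mulr_ge0 => //; first by rewrite addr_ge0 ?sqr_ge0.
  exact: mulr_ge0.
exists (((A ^+ 2 + 1) * e^-1 + (L + hbound x e) * (e^-1 * e^-1)) * A).
  exact: mulr_ge0.
move=> w w0 z hw hw0 wL wL0.
have -> : slope x w w0 z - slope x w0 w0 z =
    E ((fluctL incl E x w - fluctL incl E x w0) * incl z * fluctR incl E x w0).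
  by rewrite -linearB -!mulrBl.
apply: le_trans (nrm_condexp hE _) _; apply: le_trans (nrmM _ _) _.
have [_ h2] := nrm_fluct hx e0 hw0 wL0.
set D := _ + _ in D0 *.
suff h1 : nrm (fluctL incl E x w - fluctL incl E x w0) <= D * nrm (w - w0).
  have -> : D * A * nrm (w - w0) * nrm z = D * nrm (w - w0) * nrm z * A by ring.
  apply: ler_pM; rewrite ?nrm_ge0 //; apply: le_trans (nrmM _ _) _.
  by rewrite (nrm_incl hE) ler_wpM2r ?nrm_ge0.
set F := Ftr incl E x w; set F0 := Ftr incl E x w0.
have uw := resolvent_unit hE hx e0 hw; have uw0 := resolvent_unit hE hx e0 hw0.
have rr0 : (incl w - x)^-1 - (incl w0 - x)^-1 =
    (incl w - x)^-1 * incl (w0 - w) * (incl w0 - x)^-1.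
  have -> : incl (w0 - w) = (incl w0 - x) - (incl w - x).
    by rewrite rmorphB /=; nc_ring.
  by rewrite mulrBr mulrBl mulrK // mulVr // mul1r.
have -> : fluctL incl E x w - fluctL incl E x w0 =
   incl (F - F0) * (incl w - x)^-1 +
   incl F0 * ((incl w - x)^-1 - (incl w0 - x)^-1).
  by rewrite /fluctL -/F -/F0 rmorphB /=; nc_ring.
have hF : nrm (F - F0) <= (A ^+ 2 + 1) * nrm (w - w0).
  have -> : F - F0 = (h x w - h x w0) + (w - w0) by rewrite /htr; nc_ring.
  apply: le_trans (nrmD _ _) _; rewrite mulrDl mul1r lerD2r.
  by rewrite (htr_diff hE hx e0 e0 hw hw0); apply: nrm_slope.
have hF0 : nrm F0 <= L + hbound x e.
  apply: le_trans (nrm_Ftr hE hx e0 hw0) _.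
  by apply: lerD => //; rewrite lerDl.
have hr := nrm_resolvent hE hx e0 hw; have hr0 := nrm_resolvent hE hx e0 hw0.
apply: le_trans (nrmD _ _) _; rewrite /D mulrDl; apply: lerD.
  apply: le_trans (nrmM _ _) _; rewrite (nrm_incl hE) mulrAC.
  by apply: ler_pM; rewrite ?nrm_ge0.
apply: le_trans (nrmM _ _) _; rewrite (nrm_incl hE) -mulrA.
apply: ler_pM; rewrite ?nrm_ge0 // rr0; apply: le_trans (nrmM _ _) _.
rewrite mulrAC; apply: ler_pM; rewrite ?nrm_ge0 //.
apply: le_trans (nrmM _ _) _; rewrite (nrm_incl hE) nrm_distC.
by rewrite ler_wpM2r ?nrm_ge0.
Qed.


(** As [htr_diff] is exact, z1 = om(b) - om(b0) solves z1 = S_b z1 + (Ty t + t) with t = b - b0 and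
    S_b linear. The powers of S_b decay uniformly for b near b0, which bounds z1 by a multiple of
    ||t||. The derivative solves the equation with b0 in place of b, and the error solves it with a
    source quadratic in t. *)
Lemma fixpoint_differentiable x y (om : B -> B) b0 :
  star x = x -> star y = y ->
  (forall b, upper_half_plane b ->
     upper_half_plane (om b) /\ fixmap incl E x y b (om b) = om b) ->
  upper_half_plane b0 -> differentiable om b0.
Proof.
move=> hx hy hom /upper_half_planeP[e1 e10 hb0].
pose e := e1 / 2; have e0 : 0 < e by rewrite divr_gt0.
have near_b b : nrm (b - b0) <= e -> e *:c 1 <=p cIm b.
  move=> hb; rewrite /leA.
  have -> : cIm b - e *:c 1 =
      (cIm b0 - e1 *:c 1) + (e *:c 1 - cIm (b0 - b)).
    have -> : e1 = e + e by rewrite /e; field.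
    by rewrite cImB; nc_ring.
  apply: posD => //; apply: pos_sub_rs; first exact: star_cIm.
  by apply: le_trans (nrm_cIm _) _; rewrite nrm_distC.
have Kx := hbound_gt0 x e0; have Ky := hbound_gt0 y e0.
pose L := hbound x e + hbound y e + (nrm b0 + e).
have nb0 := nrm_ge0 b0.
have L0 : 0 < L by rewrite /L; lra.
have nrm_b b : nrm (b - b0) <= e -> nrm b <= nrm b0 + e.
  by move=> hb; rewrite -[b](subrK b0) addrC; have := nrmD b0 (b - b0); lra.
pose w2 b := h x (om b) + b.
have om2 b : nrm (b - b0) <= e -> om b = h y (w2 b) + b.
  move=> hb; have ub : upper_half_plane b.
    by apply/upper_half_planeP; exists e => //; apply: near_b.
  by have [_ {1}<-] := hom b ub.
have g1 b : nrm (b - b0) <= e -> e *:c 1 <=p cIm (om b).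
  move=> hb; have ub : upper_half_plane b.
    by apply/upper_half_planeP; exists e => //; apply: near_b.
  have [/upper_half_planeP[e' e0' h1] h2] := hom b ub.
  rewrite -h2; apply: leA_trans (near_b b hb) _.
  exact: (fixmap_region hE hx hy e0 (near_b b hb) e0' h1).
have g2 b : nrm (b - b0) <= e -> e *:c 1 <=p cIm (w2 b).
  move=> hb; apply: leA_trans (near_b b hb) _.
  exact: (step_region hE _ hx e0 (g1 b hb)).
have n2 b : nrm (b - b0) <= e -> nrm (w2 b) <= L.
  move=> hb; apply: le_trans (nrmD _ _) _.
  have := nrm_htr_bound hE hx e0 (g1 b hb); have := nrm_b b hb.
  by rewrite /L; lra.
have n1 b : nrm (b - b0) <= e -> nrm (om b) <= L.
  move=> hb; rewrite om2 //; apply: le_trans (nrmD _ _) _.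
  have := nrm_htr_bound hE hy e0 (g2 b hb); have := nrm_b b hb.
  by rewrite /L; lra.
have b0e : nrm (b0 - b0) <= e by rewrite subrr nrm0 ltW.
pose Tx b z := slope x (om b) (om b0) z; pose Ty b z := slope y (w2 b) (w2 b0) z.
have TxD b : {morph Tx b : u v / u + v}.
  by move=> u v; have := slope_linear x (om b) (om b0) 1 u v; rewrite !scale1r.
have TyD b : {morph Ty b : u v / u + v}.
  by move=> u v; have := slope_linear y (w2 b) (w2 b0) 1 u v; rewrite !scale1r.
pose S b z := Ty b (Tx b z).
have SD b : {morph S b : u v / u + v} by move=> u v; rewrite /S TxD TyD.
have SL b : linear (S b).
  by move=> a u v; rewrite /S /Tx /Ty !slope_linear.
have [tx0 tx1] := andP (rate_bounds x e0).
have [ty0 ty1] := andP (rate_bounds y e0).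
pose q := Num.max (rate x e) (rate y e).
have q0 : 0 <= q by rewrite le_max ltW.
have q1 : q < 1 by rewrite gt_max tx1.
have C0 : 0 <= L / e by rewrite divr_ge0 ?ltW.
have hS b : nrm (b - b0) <= e ->
    forall n v, nrm (iter n (S b) v) <= L / e * q ^+ n * nrm v.
  (* The base points form constant sequences: the two half-steps send the pair (om b, om b0) to
     itself, and only the vector moves. *)
  move=> hb n v; apply: (@hyp_iter_nrm _ _ (fun=> om b) (fun=> om b0)
    (fun m => iter m (S b) v) e L q e0 L0 q0) => [_|_|m k k0 IH||].
  - exact: g1.
  - exact: g1.
  - have h1 : hyp_le (rate x e * k) (w2 b) (w2 b0) (Tx b (iter m (S b) v)).
      by apply: step_contraction => //; do ?[exact: near_b | exact: g1].
    have h2 : hyp_le (rate y e * (rate x e * k)) (om b) (om b0)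
        (iter m.+1 (S b) v).
      rewrite (om2 b) // (om2 b0) //; apply: step_contraction => //;
        by [rewrite mulr_ge0 // ltW | exact: near_b | exact: g2].
    apply: hyp_leW h2; first exact: rate_mul_le.
    by apply: pos_le (g1 b0 b0e); exact/pos_rs/ltW.
  - exact: n1.
  - exact: n1.
have [V [VL VS]] := affine_fixpoint q0 q1 C0 (SL b0) (hS b0 b0e).
set Ax := fluct_bound x e L ^+ 2; set Ay := fluct_bound y e L ^+ 2.
have Ax0 : 0 <= Ax := sqr_ge0 _; have Ay0 : 0 <= Ay := sqr_ge0 _.
have nTx b z : nrm (b - b0) <= e -> nrm (Tx b z) <= Ax * nrm z.
  by move=> hb; apply: nrm_slope => //; [exact: g1|exact: g1|exact: n1|exact: n1].
have nTy b z : nrm (b - b0) <= e -> nrm (Ty b z) <= Ay * nrm z.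
  by move=> hb; apply: nrm_slope => //; [exact: g2|exact: g2|exact: n2|exact: n2].
set CC := L / e / (1 - q).
have CC0 : 0 <= CC by rewrite /CC divr_ge0 // subr_ge0 ltW.
have nTyt b (t : B) : nrm (b - b0) <= e -> nrm (Ty b t + t) <= (Ay + 1) * nrm t.
  move=> hb; apply: le_trans (nrmD _ _) _; rewrite mulrDl mul1r lerD2r.
  exact: nTy.
pose Lt (t : B) := V (Ty b0 t + t).
have LtL : linear Lt.
  move=> a u v; rewrite /Lt -VL; congr (V _).
  by rewrite /Ty slope_linear; nc_ring.
have nLt (t : B) : nrm (Lt t) <= CC * (Ay + 1) * nrm t.
  rewrite -mulrA.
  apply: le_trans (affine_fixpoint_bound q0 q1 C0 (SD b0) (hS b0 b0e) (VS _)) _.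
  by rewrite ler_wpM2l // nTyt.
have [Dx Dx0 hDx] := slope_lipschitz hx e0 (ltW L0).
have [Dy Dy0 hDy] := slope_lipschitz hy e0 (ltW L0).
set C1 := CC * (Ay + 1).
have C10 : 0 <= C1 by rewrite mulr_ge0 // addr_ge0.
pose C2 := Ax * C1 + 1.
have C20 : 0 <= C2 by rewrite addr_ge0 // mulr_ge0.
pose D := Dy * C2 * (Ax * C1) + Ay * (Dx * C1 * C1) + Dy * C2.
have D0 : 0 <= D.
  by rewrite /D; apply: addr_ge0; [apply: addr_ge0|]; repeat (apply: mulr_ge0 => //).
apply: (differentiable_quadratic LtL nLt C10 (mulr_ge0 CC0 D0) e0).
move=> t te; set b := t + b0; have nt := nrm_ge0 t.
have hb : nrm (b - b0) <= e by rewrite addrK.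
set z1 := om b - om b0; set z2 := w2 b - w2 b0.
have z2E : z2 = Tx b z1 + t.
  rewrite /Tx -(htr_diff hE hx e0 e0 (g1 b hb) (g1 b0 b0e)).
  by rewrite /z2 /w2 /b; nc_ring.
have z1E : z1 = Ty b z2 + t.
  rewrite /Ty -(htr_diff hE hy e0 e0 (g2 b hb) (g2 b0 b0e)).
  by rewrite /z1 (om2 b hb) (om2 b0 b0e) {2}/b; nc_ring.
have z1S : z1 = S b z1 + (Ty b t + t) by rewrite {1}z1E z2E TyD addrA.
have nz1 : nrm z1 <= C1 * nrm t.
  rewrite /C1 -mulrA.
  apply: le_trans (affine_fixpoint_bound q0 q1 C0 (SD b) (hS b hb) z1S) _.
  by rewrite ler_wpM2l // nTyt.
have nTz1 : nrm (Tx b z1) <= Ax * C1 * nrm t.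
  by apply: le_trans (nTx _ _ hb) _; rewrite -mulrA ler_wpM2l.
have nz2 : nrm z2 <= C2 * nrm t.
  by rewrite z2E; apply: le_trans (nrmD _ _) _; rewrite mulrDl mul1r lerD2r.
set d := z1 - Lt t.
have TyB b' u v : Ty b' (u - v) = Ty b' u - Ty b' v.
  by apply/eqP; rewrite -subr_eq0 opprB addrA -[Ty b' _ + _]TyD subrK subrr.
have SB b' u v : S b' (u - v) = S b' u - S b' v.
  by apply/eqP; rewrite -subr_eq0 opprB addrA -[S b' _ + _]SD subrK subrr.
(* In each term a change of base point, of order t, acts on a vector of order t. *)
pose s := (Ty b (Tx b z1) - Ty b0 (Tx b z1)) + Ty b0 (Tx b z1 - Tx b0 z1)
  + (Ty b t - Ty b0 t).
have dE : d = S b0 d + s.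
  rewrite /s TyB -/(S b0 z1) -/(S b z1) /d SB {1}z1S {1}/Lt VS -/(Lt t).
  by nc_ring.
have ns : nrm s <= D * nrm t ^+ 2.
  apply: le_trans (nrmD _ _) _; rewrite /D [leRHS]mulrDl; apply: lerD; last first.
    apply: le_trans (hDy _ _ _ (g2 b hb) (g2 b0 b0e) (n2 b hb) (n2 b0 b0e)) _.
    rewrite expr2 [leRHS]mulrA ler_wpM2r // -mulrA ler_wpM2l //.
  apply: le_trans (nrmD _ _) _; rewrite [leRHS]mulrDl; apply: lerD.
    apply: le_trans (hDy _ _ _ (g2 b hb) (g2 b0 b0e) (n2 b hb) (n2 b0 b0e)) _.
    rewrite -/z2.
    have -> : Dy * C2 * (Ax * C1) * nrm t ^+ 2 =
      Dy * (C2 * nrm t) * (Ax * C1 * nrm t) by ring.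
    by apply: ler_pM; rewrite ?nrm_ge0 ?mulr_ge0 ?nrm_ge0 // ler_wpM2l.
  apply: le_trans (nTy _ _ b0e) _; rewrite -[leRHS]mulrA ler_wpM2l //.
  apply: le_trans (hDx _ _ _ (g1 b hb) (g1 b0 b0e) (n1 b hb) (n1 b0 b0e)) _.
  rewrite -/z1.
  have -> : Dx * C1 * C1 * nrm t ^+ 2 =
    Dx * (C1 * nrm t) * (C1 * nrm t) by ring.
  by apply: ler_pM; rewrite ?nrm_ge0 ?mulr_ge0 ?nrm_ge0 // ler_wpM2l.
rewrite -/z1 -/d -mulrA.
apply: le_trans (affine_fixpoint_bound q0 q1 C0 (SD b0) (hS b0 b0e) dE) _.
by rewrite ler_wpM2l.
Qed.

End Analyticity.

(** * Freeness *)

Section Freeness.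
Context {R : realType} {M B : cstar_alg R}.
Variables (incl : {lrmorphism B -> M}) (E : {linear M -> B}).
Hypothesis hE : opv_prob_space incl E.
Implicit Types (a c p q x y : M) (b w z : B).

Lemma generated_algP x a :
  generated_alg incl x a <->
  (forall S : set M, GRing.subalg_closed [in S] ->
     (forall b, S (incl b)) -> S x -> S a).
Proof.
split=> [h S hS hb hx|h S /= [hS hsub]].
  by apply: (h S); split=> //= z [[b _ <-]|->].
by apply: h => // [b|]; apply: hsub; [left; exists b | right].
Qed.

Lemma generated_alg_incl x b : generated_alg incl x (incl b).
Proof. by apply/generated_algP => S _ h _. Qed.

Lemma generated_alg_id x : generated_alg incl x x.
Proof. by apply/generated_algP => S _ _. Qed.

Lemma generated_alg_lin x (k : R[i]) a c : generated_alg incl x a ->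
  generated_alg incl x c -> generated_alg incl x (k *: a + c).
Proof.
move=> ha hc; apply/generated_algP => S hS hb hx.
have [_ h _] := hS; apply/set_mem/h; apply/mem_set.
  by move/generated_algP: ha; apply.
by move/generated_algP: hc; apply.
Qed.

Lemma generated_algM x a c : generated_alg incl x a ->
  generated_alg incl x c -> generated_alg incl x (a * c).
Proof.
move=> ha hc; apply/generated_algP => S hS hb hx.
have [_ _ h] := hS; apply/set_mem/h; apply/mem_set.
  by move/generated_algP: ha; apply.
by move/generated_algP: hc; apply.
Qed.

Lemma generated_alg1 x : generated_alg incl x 1.
Proof. by rewrite -(rmorph1 incl); apply: generated_alg_incl. Qed.

Lemma generated_algD x a c : generated_alg incl x a ->
  generated_alg incl x c -> generated_alg incl x (a + c).
Proof. by move=> ha hc; rewrite -[a]scale1r; apply: generated_alg_lin. Qed.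

Lemma generated_algZ x (k : R[i]) a : generated_alg incl x a ->
  generated_alg incl x (k *: a).
Proof.
move=> ha; rewrite -[_ *: _]addr0 -(rmorph0 incl).
by apply: generated_alg_lin => //; apply: generated_alg_incl.
Qed.

Lemma generated_alg_star x a : star x = x ->
  generated_alg incl x a -> generated_alg incl x (star a).
Proof.
move=> hx /generated_algP h; apply: (h [set u | generated_alg incl x (star u)]).
- split=> [|k u v /set_mem hu /set_mem hv|u v /set_mem hu /set_mem hv];
    apply/mem_set => /=.
  + by rewrite star1; apply: generated_alg1.
  + by rewrite starD starZ; apply: generated_alg_lin.
  + by rewrite starM; apply: generated_algM.
- by move=> b /=; rewrite -(incl_star hE); apply: generated_alg_incl.
- by rewrite /= hx; apply: generated_alg_id.
Qed.

(** Bridges the gap between the hypothesis of freeness, stated for [generated_alg], and resolvents,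
    which in general lie only in its norm closure. *)
Definition nrm_closure (S : set M) : set M :=
  [set a | forall e : R, 0 < e -> exists2 s, S s & nrm (a - s) <= e].

Local Notation cl x := (nrm_closure (generated_alg incl x)).

Lemma cl_gen x a : generated_alg incl x a -> cl x a.
Proof. by move=> h e e0; exists a; rewrite // subrr nrm0 ltW. Qed.

Lemma clD x a c : cl x a -> cl x c -> cl x (a + c).
Proof.
move=> ha hc e e0; have e2 : 0 < e / 2 by rewrite divr_gt0.
have [s hs has] := ha _ e2; have [t ht hct] := hc _ e2.
exists (s + t); first exact: generated_algD.
rewrite opprD addrACA; apply: le_trans (nrmD _ _) _.
by have := lerD has hct; rewrite -splitr.
Qed.

Lemma clM x a c : cl x a -> cl x c -> cl x (a * c).
Proof.
move=> ha hc e e0; have na := nrm_ge0 a; have nc := nrm_ge0 c.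
pose K := nrm a + nrm c + 1; have K0 : 0 < K by rewrite /K; lra.
pose d := Num.min 1 (e / K).
have d0 : 0 < d by rewrite lt_min ltr01 divr_gt0.
have d1 : d <= 1 by rewrite ge_min lexx.
have dK : d * K <= e.
  have : d <= e / K by rewrite ge_min lexx orbT.
  by rewrite ler_pdivlMr.
have [s hs has] := ha _ d0; have [t ht hct] := hc _ d0.
exists (s * t); first exact: generated_algM.
have -> : a * c - s * t = (a - s) * c + s * (c - t) by nc_ring.
have ns : nrm s <= nrm a + 1.
  by rewrite -[s](subKr a); have := nrmB a (a - s); lra.
apply: le_trans (nrmD _ _) _; apply: le_trans (lerD (nrmM _ _) (nrmM _ _)) _.
apply: le_trans dK; rewrite /K -addrA mulrDr [leRHS]addrC.
have h1 : nrm (a - s) * nrm c <= d * nrm c by rewrite ler_wpM2r.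
have h2 : nrm s * nrm (c - t) <= (nrm a + 1) * d.
  by apply: ler_pM; rewrite ?nrm_ge0.
by lra.
Qed.

Lemma cl_incl x b : cl x (incl b).
Proof. by apply: cl_gen; apply: generated_alg_incl. Qed.

Lemma clB x a c : cl x a -> cl x c -> cl x (a - c).
Proof.
move=> ha hc; apply: clD => //.
have -> : - c = incl (- 1) * c by rewrite rmorphN rmorph1 mulN1r.
by apply: clM => //; apply: cl_incl.
Qed.

Lemma cl_star x a : star x = x -> cl x a -> cl x (star a).
Proof.
move=> hx ha e e0; have [s hs has] := ha _ e0.
exists (star s); first exact: generated_alg_star.
by rewrite -starB nrm_star.
Qed.

(** X^-1 is a multiple of (1 - (1 + k X))^-1 with ||1 + k X|| < 1, whose Neumann sums lie in the
    generated algebra. This also covers w near the real axis, where an expansion in powers of x may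
    diverge. *)
Lemma cl_resolvent x w (e : R) : star x = x -> 0 < e -> e *:c 1 <=p cIm w ->
  cl x (incl w - x)^-1.
Proof.
move=> hx e0 hw; have hX := resolvent_dissipative hE hx hw.
have uX := resolvent_unit hE hx e0 hw.
have [d d0 hd] := dissipative_contraction e0 hX.
set X := incl w - x in hX uX hd *; set k := 'i * d%:C%C in hd.
have gX : generated_alg incl x (1 + k *: X).
  rewrite addrC; apply: generated_alg_lin; last exact: generated_alg1.
  rewrite /X addrC -scaleN1r; apply: generated_alg_lin.
    exact: generated_alg_id.
  exact: generated_alg_incl.
have gS n : generated_alg incl x (\sum_(i < n) (1 + k *: X) ^+ i).
  have gP m : generated_alg incl x ((1 + k *: X) ^+ m).
    elim: m => [|m IH]; first exact: generated_alg1.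
    by rewrite exprS; apply: generated_algM.
  elim: n => [|n IH].
    by rewrite big_ord0 -(rmorph0 incl); apply: generated_alg_incl.
  by rewrite big_ord_recr; apply: generated_algD.
have [uN [C hC]] := neumann hd.
have XV : X^-1 = (- k) *: (1 - (1 + k *: X))^-1.
  apply: (mulrI uX); rewrite mulrV // -scalerAr scalerAl.
  have -> : - k *: X = 1 - (1 + k *: X) by rewrite opprD addNKr scaleNr.
  by rewrite mulrV.
move=> r r0; have nk : 0 <= nrm (k *: (1 : M)) := nrm_ge0 _.
have [N hN] := geom_lt (nrm (k *: (1 : M)) * C) (nrm_ge0 _) hd r0.
exists ((- k) *: \sum_(i < N) (1 + k *: X) ^+ i); first exact: generated_algZ.
rewrite XV -scalerBr -[_ - _]mul1r scalerAl.
apply: le_trans (nrmM _ _) _; rewrite scaleNr nrmN.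
apply: ltW; apply: le_lt_trans (hN N (leqnn N)).
by rewrite -mulrA ler_wpM2l.
Qed.

Fixpoint centered_word (A : bool -> set M) (s : seq (bool * M)) : Prop :=
  if s is p :: s' then [/\ A p.1 p.2, E p.2 = 0 & centered_word A s'] else True.

Definition wprod (s : seq (bool * M)) : M := \prod_(p <- s) p.2.

(** [sorted] compares neighbours only, so for this non-transitive relation it expresses that the
    labels alternate. *)
Local Notation alternating u := (sorted (fun i j : bool => i != j) u).

Lemma centered_word_cat A s t :
  centered_word A (s ++ t) <-> centered_word A s /\ centered_word A t.
Proof.
elim: s => [|p s IH] /=; first by split=> [|[]].
split=> [[h1 h2 /IH[h3 h4]]|[[h1 h2 h3] h4]]; first by [].
by split=> //; apply/IH.
Qed.

(** * Alternating words in the closed algebras *)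

Section FreePair.
Variables x y : M.
Hypotheses (hx : star x = x) (hy : star y = y).
Hypothesis hfree : free_over incl E x y.

Local Notation gen := (fun i : bool => if i then generated_alg incl x
                                       else generated_alg incl y).
Local Notation clg := (fun i : bool => nrm_closure (gen i)).

Lemma free_word_gen s : s <> [::] -> centered_word gen s ->
  alternating (unzip1 s) -> E (wprod s) = 0.
Proof.
move=> s0 hs alt; pose d : bool * M := (true, 0).
have -> : wprod s = \prod_(0 <= j < size s) (nth d s j).2.
  by rewrite /wprod (big_nth d).
apply: (hfree (i := fun j => (nth d s j).1)).
- by case: s s0 {hs alt}.
- move=> j; elim: s j hs {s0 alt} => //= p s IH [|j] [h1 h2 h3] //=.
  by rewrite ltnS; apply: IH.
- move=> j; case: s alt {hs s0} => //= p s; elim: s p j => //= q s IH p j.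
  by move=> /andP[pq hq]; case: j => [|j] //; rewrite ltnS; apply: IH.
Qed.

(** Recentring an approximant s at most doubles the error, since E[a] = 0 gives ||E[s]|| <= ||a -
    s||. *)
Lemma clg_approx i a (e : R) : clg i a -> E a = 0 -> 0 < e ->
  exists c, [/\ gen i c, E c = 0 & nrm (a - c) <= e].
Proof.
move=> ha Ea e0; have e2 : 0 < e / 2 by rewrite divr_gt0.
have [s hs has] := ha _ e2; exists (s - incl (E s)); split.
- case: i hs {ha} => hs; rewrite -scaleN1r addrC; apply: generated_alg_lin => //;
  exact: generated_alg_incl.
- by rewrite linearB (condexp_id hE) subrr.
- rewrite opprB addrA addrAC; apply: le_trans (nrmD _ _) _.
  rewrite (nrm_incl hE).
  have : nrm (E s) <= nrm (a - s).
    by rewrite -nrmN -[- E s]add0r -{1}Ea -linearB; apply: (nrm_condexp hE).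
  by lra.
Qed.

Lemma word_approx s (e : R) : centered_word clg s -> 0 < e ->
  exists t, [/\ centered_word gen t, unzip1 t = unzip1 s
    & nrm (wprod s - wprod t) <= e].
Proof.
elim: s e => [|[i a] s IH] e /=.
  by move=> _ e0; exists [::]; split=> //; rewrite subrr nrm0 ltW.
move=> [ha Ea hs] e0; have na := nrm_ge0 a; have nw := nrm_ge0 (wprod s).
pose K := nrm a + nrm (wprod s) + 1; have K0 : 0 < K by rewrite /K; lra.
pose d := Num.min 1 (e / K).
have d0 : 0 < d by rewrite lt_min ltr01 divr_gt0.
have d1 : d <= 1 by rewrite ge_min lexx.
have dK : d * K <= e.
  have : d <= e / K by rewrite ge_min lexx orbT.
  by rewrite ler_pdivlMr.
have [t [ht ut wt]] := IH d hs d0.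
have [c [hc Ec ac]] := clg_approx ha Ea d0.
exists ((i, c) :: t); split=> //=; first by rewrite ut.
rewrite /wprod !big_cons -/(wprod s) -/(wprod t) /=.
have -> : a * wprod s - c * wprod t =
  (a - c) * wprod s + c * (wprod s - wprod t) by nc_ring.
have nc : nrm c <= nrm a + 1.
  by rewrite -[c](subKr a); have := nrmB a (a - c); lra.
apply: le_trans (nrmD _ _) _; apply: le_trans (lerD (nrmM _ _) (nrmM _ _)) _.
apply: le_trans dK; rewrite /K -addrA mulrDr [leRHS]addrC.
have h1 : nrm (a - c) * nrm (wprod s) <= d * nrm (wprod s) by rewrite ler_wpM2r.
have h2 : nrm c * nrm (wprod s - wprod t) <= (nrm a + 1) * d.
  by apply: ler_pM; rewrite ?nrm_ge0.
by lra.
Qed.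

Lemma free_word s : s <> [::] -> centered_word clg s ->
  alternating (unzip1 s) -> E (wprod s) = 0.
Proof.
move=> s0 hs alt; apply: nrm_limit => e e0.
have [t [ht ut wt]] := word_approx hs e0.
have t0 : t <> [::] by move=> t0; apply: s0; move: ut; rewrite t0; case: s {hs alt wt}.
rewrite -[E _]subr0 -(free_word_gen t0 ht) ?ut // -linearB.
exact: le_trans (nrm_condexp hE _) wt.
Qed.

Lemma clg_star i a : clg i a -> clg i (star a).
Proof. by case: i; apply: cl_star. Qed.

Definition wstar (s : seq (bool * M)) := 
  rev (map (fun u : bool * M => (u.1, star u.2)) s).

Lemma wprod_cat s t : wprod (s ++ t) = wprod s * wprod t.
Proof. by rewrite /wprod big_cat. Qed.

Lemma wprod_wstar s : wprod (wstar s) = star (wprod s).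
Proof.
elim: s => [|p s IH]; first by rewrite /wprod !big_nil star1.
rewrite /wstar map_cons rev_cons -cats1 wprod_cat -/(wstar s) IH.
by rewrite /wprod !big_cons big_nil mulr1 /= starM.
Qed.

Lemma centered_wstar s : centered_word clg s -> centered_word clg (wstar s).
Proof.
elim: s => [|p s IH] //= [h1 h2 h3].
rewrite /wstar map_cons rev_cons -cats1; apply/centered_word_cat.
split; first exact: IH.
split=> //=; first exact: clg_star.
by rewrite (condexp_star hE) h2 star0.
Qed.

Lemma unzip1_wstar s : unzip1 (wstar s) = rev (unzip1 s).
Proof. by rewrite /wstar /unzip1 map_rev -map_comp. Qed.

(** The two sides differ by the expectation of the word s k [star s], with k the centred part of a b
    [star a]. As s does not end in label i, this palindrome alternates and freeness kills it. *)
Lemma condexp_sandwich s i a b : centered_word clg s ->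
  alternating (rcons (unzip1 s) i) -> clg i a ->
  E (wprod s * a * incl b * star (wprod s * a)) =
  E (wprod s * incl (E (a * incl b * star a)) * star (wprod s)).
Proof.
move=> hs alt ha; apply/eqP; rewrite -subr_eq0 -linearB; apply/eqP.
pose k := a * incl b * star a - incl (E (a * incl b * star a)).
have -> : wprod s * a * incl b * star (wprod s * a) -
    wprod s * incl (E (a * incl b * star a)) * star (wprod s) =
    wprod (s ++ (i, k) :: wstar s).
  rewrite wprod_cat /wprod big_cons -/(wprod s) -/(wprod (wstar s)) wprod_wstar.
  by rewrite /= /k starM; nc_ring.
have ck : clg i k.
  by case: i ha {alt} => ha; (apply: clB; last exact: cl_incl);
    (apply: clM; last exact: cl_star); (apply: clM => //; exact: cl_incl).
apply: free_word.
- by case: (s).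
- apply/centered_word_cat; split=> //=; split=> //=.
    by rewrite /k linearB (condexp_id hE) subrr.
  exact: centered_wstar.
- rewrite /unzip1 map_cat /= -!/(unzip1 _) unzip1_wstar sorted_cat_cons alt /=.
  rewrite -[path _ _ _]/(sorted _ (i :: rev (unzip1 s))) -rev_rcons rev_sorted.
  by rewrite (eq_sorted (e' := fun i j : bool => i != j)) // => u v; rewrite eq_sym.
Qed.


(** * The subordination identity for x + y *)

Section Convolution.
Variables (b w1 w2 : B) (e : R).
Hypotheses (e0 : 0 < e) (hb : e *:c 1 <=p cIm b).
Hypotheses (h1 : e *:c 1 <=p cIm w1) (h2 : e *:c 1 <=p cIm w2).
Hypothesis hF : Ftr incl E x w1 = Ftr incl E y w2.
Hypothesis hS : Ftr incl E x w1 + b = w1 + w2.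

Local Notation a1 := (fluctL incl E x w1).
Local Notation a2 := (fluctL incl E y w2).
Local Notation F := (Ftr incl E x w1).

(** The prefix t will be empty or the letter a2, which treats (a1 a2)^n and a2 (a1 a2)^n
    together. *)
Definition alt_word (t : seq (bool * M)) (n : nat) : seq (bool * M) :=
  iter n (fun s => s ++ [:: (true, a1); (false, a2)]) t.

Lemma cl_fluctL i : clg i (if i then a1 else a2).
Proof.
case: i; (apply: clB; last by rewrite -(rmorph1 incl); exact: cl_incl);
  (apply: clM; first exact: cl_incl).
  exact: cl_resolvent hx e0 h1.
exact: cl_resolvent hy e0 h2.
Qed.

Lemma condexp_a1 : E a1 = 0.
Proof. exact: (condexp_fluctL hE hx e0 h1). Qed.

Lemma condexp_a2 : E a2 = 0.
Proof. exact: (condexp_fluctL hE hy e0 h2). Qed.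

Lemma wprod_alt t n : wprod (alt_word t n) = wprod t * (a1 * a2) ^+ n.
Proof.
elim: n => [|n IH]; first by rewrite expr0 mulr1.
rewrite /alt_word iterS -/(alt_word t n) wprod_cat IH exprSr mulrA.
by rewrite /wprod !big_cons big_nil mulr1.
Qed.

Lemma alt_wordP t n : centered_word clg t ->
  alternating (rcons (unzip1 t) true) ->
  centered_word clg (alt_word t n) /\
  alternating (rcons (unzip1 (alt_word t n)) true).
Proof.
move=> ht ta; elim: n => [|n [IH1 IH2]]; first by [].
rewrite /alt_word iterS -/(alt_word t n); split.
  apply/centered_word_cat; split=> //=; split=> //.
  - exact: (cl_fluctL true).
  - exact: condexp_a1.
  - by split=> //; [exact: (cl_fluctL false) | exact: condexp_a2].
by rewrite /unzip1 map_cat /= rcons_cat /= sorted_cat_cons IH2.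
Qed.

(** From Im w1 <= ||w1|| + e and Im b >= e, the element Im b dominates the fraction e / (||w1|| + e)
    of Im w1. *)
Definition conv_rate : R := 1 - e / (nrm w1 + e).

Lemma conv_rate_bounds : 0 <= conv_rate < 1.
Proof.
have n1 := nrm_ge0 w1; have L0 : 0 < nrm w1 + e by rewrite ltr_wpDl.
rewrite /conv_rate subr_ge0 ler_pdivrMr // mul1r lerDr n1 /=.
by rewrite gtrDl oppr_lt0 divr_gt0.
Qed.

Lemma conv_contraction : cIm w1 - cIm b <=p conv_rate *:c cIm w1.
Proof.
have n1 := nrm_ge0 w1; have L0 : 0 < nrm w1 + e by rewrite ltr_wpDl.
rewrite /leA.
have eL : e / (nrm w1 + e) * (nrm w1 + e) = e by rewrite divfK // gt_eqF.
have -> : conv_rate *:c cIm w1 - (cIm w1 - cIm b) =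
   (cIm b - e *:c 1) + (e / (nrm w1 + e)) *:c ((nrm w1 + e) *:c 1 - cIm w1).
  have -> : (e / (nrm w1 + e)) *:c ((nrm w1 + e) *:c 1 - cIm w1) =
      (e / (nrm w1 + e) * (nrm w1 + e)) *:c 1 - (e / (nrm w1 + e)) *:c cIm w1.
    by move: (e / _) => k; nc_ring.
  by rewrite eL /conv_rate; move: (e / _) => k; nc_ring.
apply: posD => //; apply: posZ; first by rewrite divr_ge0 // ltW.
apply: pos_sub_rs; first exact: star_cIm.
by apply: le_trans (nrm_cIm _) _; rewrite lerDl ltW.
Qed.

(** Each pair is stripped from the inside: removing a2 leaves Im w1 - Im b, where the strict factor
    is gained; removing a1 leaves Im w2 - Im b, where Im b is merely dropped. *)
Lemma alt_word_decay t n : centered_word clg t ->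
  alternating (rcons (unzip1 t) true) ->
  E (wprod (alt_word t n) * incl (cIm w2) * star (wprod (alt_word t n))) <=p
  (conv_rate ^+ n) *:c E (wprod t * incl (cIm w2) * star (wprod t)).
Proof.
move=> ht ta; have [r0 _] := andP conv_rate_bounds.
have hpos (b' : B) : pos b' -> forall p, pos (E (p * incl b' * star p)).
  move=> pb p; apply: (condexp_pos hE); rewrite -{1}(starK p).
  by apply: pos_conj; apply: (incl_pos hE).
elim: n => [|n IH]; first by rewrite expr0 scale1r; apply: leA_refl.
have [hw wa] := alt_wordP n ht ta.
set s := alt_word t n in IH hw wa *.
have -> : wprod (alt_word t n.+1) = wprod (rcons s (true, a1)) * a2.
  rewrite -cats1 wprod_cat /alt_word iterS -/(alt_word t n) -/s wprod_cat.
  by rewrite /wprod !big_cons big_nil !mulr1 mulrA.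
have hs1 : centered_word clg (rcons s (true, a1)).
  rewrite -cats1; apply/centered_word_cat; split=> //=.
  by split=> //; [exact: (cl_fluctL true) | exact: condexp_a1].
have as1 : alternating (rcons (unzip1 (rcons s (true, a1))) false).
  rewrite /unzip1 map_rcons /= -[rcons (rcons _ _) _]cats1 -cats1 -catA /=.
  by rewrite sorted_cat_cons wa.
rewrite (condexp_sandwich _ hs1 as1 (cl_fluctL false)).
have h_y : htr incl E y w2 = w1 - b.
  by rewrite /htr -hF; apply/eqP; rewrite subr_eq addrAC -hS addrK.
have h_x : htr incl E x w1 = w2 - b.
  have -> : w2 - b = w1 + w2 - b - w1 by nc_ring.
  by rewrite -hS addrK.
rewrite (cIm_htr hE hy e0 h2).1 h_y cImB.
have ws1 : wprod (rcons s (true, a1)) = wprod s * a1.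
  by rewrite -cats1 wprod_cat /wprod big_cons big_nil mulr1.
apply: (@leA_trans _ _ _ (conv_rate *:c
    E (wprod s * a1 * incl (cIm w1) * star (wprod s * a1)))).
  rewrite ws1 /leA -linearZ -linearB.
  have -> : conv_rate *:c (wprod s * a1 * incl (cIm w1) * star (wprod s * a1)) -
    wprod s * a1 * incl (cIm w1 - cIm b) * star (wprod s * a1) =
    wprod s * a1 * incl (conv_rate *:c cIm w1 - (cIm w1 - cIm b)) *
      star (wprod s * a1).
    move: (cIm w1) (cIm b) => v v'.
    have -> : incl (conv_rate *:c v - (v - v')) =
      conv_rate *:c incl v - incl (v - v') by rewrite linearB linearZ.
    by nc_ring.
  apply: hpos; exact: conv_contraction.
rewrite exprS rmorphM -scalerA; apply: leAZ => //.
rewrite (condexp_sandwich _ hw wa (cl_fluctL true)).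
apply: leA_trans IH.
rewrite (cIm_htr hE hx e0 h1).1 h_x cImB rmorphB mulrBr mulrBl linearB.
rewrite /leA opprB addrCA subrr addr0; apply: hpos.
by apply: pos_le hb; exact/pos_rs/ltW.
Qed.

(** Schwarz, applied to the adjoint, bounds the square by ||q||^2 ||E[p star p]||, and Im w2 >= e
    inserts the weight whose decay is known. The size of q is irrelevant as long as it is fixed. *)
Lemma alt_word_vanish t q : centered_word clg t ->
  alternating (rcons (unzip1 t) true) ->
  exists C, forall n, nrm (E (wprod (alt_word t n) * q)) ^+ 2 <=
    C * conv_rate ^+ n.
Proof.
move=> ht ta; have [r0 _] := andP conv_rate_bounds.
set K := nrm (E (wprod t * incl (cIm w2) * star (wprod t))).
exists (nrm q ^+ 2 * (e^-1 * K)) => n.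
set p := wprod (alt_word t n).
have ps : star (E (p * q)) = E (star q * star p) by rewrite -(condexp_star hE) starM.
rewrite -nrm_star ps -nrm_cstar.
have h : star (E (star q * star p)) * E (star q * star p) <=p
    nrm q ^+ 2 *:c E (p * star p).
  apply: leA_trans (condexp_schwarz hE _) _; rewrite -linearZ.
  apply: (condexp_le hE).
  have -> : star (star q * star p) * (star q * star p) =
      star (star p) * (star (star q) * star q) * star p.
    by rewrite !starM !starK !mulrA.
  have -> : nrm q ^+ 2 *:c (p * star p) =
      star (star p) * (nrm q ^+ 2 *:c 1) * star p.
    by rewrite starK; nc_ring.
  by apply: leA_conj; apply: starM_le; rewrite nrm_star.
have h' : E (p * star p) <=p e^-1 *:c E (p * incl (cIm w2) * star p).
  rewrite -linearZ; apply: (condexp_le hE).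
  have -> : p * star p = e^-1 *:c (p * incl (e *:c 1) * star p).
    have ee : e^-1%:C%C * e%:C%C = 1 :> R[i] by rewrite -rmorphM mulVf // gt_eqF.
    by rewrite incl_rs -scalerAr -!scalerAl scalerA ee scale1r mulr1.
  apply: leAZ; first by rewrite invr_ge0 ltW.
  by rewrite -{1 3}(starK p); apply: leA_conj; apply: (incl_le hE).
have ei : 0 <= e^-1 by rewrite invr_ge0 ltW.
apply: le_trans (nrm_mono (pos_starM _) h) _.
rewrite nrmZr ger0_norm ?sqr_ge0 // -mulrA ler_wpM2l ?sqr_ge0 //.
have pp : pos (E (p * star p)).
  by apply: (condexp_pos hE); rewrite -{1}(starK p); apply: pos_starM.
apply: le_trans (nrm_mono pp (leA_trans h' (leAZ ei (alt_word_decay n ht ta)))) _.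
by rewrite !nrmZr !ger0_norm ?exprn_ge0 // -/K [_ ^+ _ * K]mulrC mulrA.
Qed.

Theorem free_convolution : Gtr incl E (x + y) b = Gtr incl E x w1.
Proof.
have [q0 q1] := andP conv_rate_bounds.
have hxy : star (x + y) = x + y by rewrite starD hx hy.
have uW := resolvent_unit hE hxy e0 hb.
have u1 := resolvent_unit hE hx e0 h1.
have u2 := resolvent_unit hE hy e0 h2.
have FG := FtrK hE hx e0 h1; have GF := GtrK hE hx e0 h1.
set G := Gtr incl E x w1 in FG GF *.
pose r1 := (incl w1 - x)^-1; pose r2 := (incl w2 - y)^-1.
set W := incl b - (x + y) in uW *.
pose u := incl F * r1.
have uF : incl F \is a GRing.unit.
  by apply/unitrP; exists (incl G); rewrite -!rmorphM FG GF rmorph1.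
have uu : u \is a GRing.unit by rewrite unitrMl // unitrV.
have a1E : a1 = u - 1 by [].
have a2E : a2 = incl F * r2 - 1 by rewrite hF.
have WE : W = (incl w1 - x) + (incl w2 - y) - incl F.
  have -> : F = w1 + w2 - b by rewrite -hS addrK.
  by rewrite /W rmorphB rmorphD /=; nc_ring.
have uWr : u * W * r2 = 1 - a1 * a2.
  rewrite a1E a2E WE /u.
  have -> : incl F * r1 * (incl w1 - x + (incl w2 - y) - incl F) * r2 =
    incl F * (r1 * (incl w1 - x)) * r2 + incl F * r1 * ((incl w2 - y) * r2)
    - incl F * r1 * incl F * r2 by nc_ring.
  by rewrite mulVr // mulrV //; nc_ring.
(* Invertibility is inherited from u, W and r2, not from a convergent series. *)
have uN : 1 - a1 * a2 \is a GRing.unit.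
  by rewrite -uWr unitrMl ?unitrV // unitrMl.
pose z := (1 - a1 * a2)^-1.
have zE : z = 1 + a1 * a2 * z.
  by apply/eqP; rewrite -subr_eq -{1}[z]mul1r -mulrBl mulrV.
have WV : W^-1 = r2 * z * u.
  apply: (mulrI uW); rewrite mulrV //; apply: (mulrI uu).
  by rewrite mulr1 !mulrA uWr mulrV // mul1r.
have FW : F * E W^-1 = E ((1 + a2) * z * (1 + a1)).
  have -> : 1 + a2 = incl F * r2 by rewrite a2E addrC subrK.
  have -> : 1 + a1 = u by rewrite a1E addrC subrK.
  by rewrite WV -(condexpMl hE) !mulrA.
(* The remainder after n terms of the expansion of z; D 0 is F E[W^-1]. *)
pose D n := E ((1 + a2) * (a1 * a2) ^+ n * z * (1 + a1)).
have t0 : centered_word clg [::] /\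
    alternating (rcons (unzip1 ([::] : seq (bool * M))) true) by [].
have t2 : centered_word clg [:: (false, a2)] /\
    alternating (rcons (unzip1 [:: (false, a2)]) true).
  by split=> //=; split=> //; [exact: (cl_fluctL false) | exact: condexp_a2].
have vanish t n : centered_word clg t ->
    alternating (rcons (unzip1 t) true) ->
    E (wprod t * (a1 * a2) ^+ n * a1) = 0 /\
    E (wprod t * (a1 * a2) ^+ n.+1) = 0.
  move=> ht ta; split.
    have [hw wa] := alt_wordP n ht ta.
    have -> : wprod t * (a1 * a2) ^+ n * a1 =
        wprod (rcons (alt_word t n) (true, a1)).
      by rewrite -cats1 wprod_cat wprod_alt /wprod big_cons big_nil mulr1.
    apply: free_word; first by case: (alt_word t n).
      rewrite -cats1; apply/centered_word_cat; split=> //=.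
      by split=> //; [exact: (cl_fluctL true) | exact: condexp_a1].
    by rewrite /unzip1 map_rcons.
  have [hw wa] := alt_wordP n.+1 ht ta.
  rewrite -wprod_alt; apply: free_word => //.
    by rewrite /alt_word iterS; case: (iter _ _ _).
  by move: wa; rewrite -cats1 => /cat_sorted2[].
have w0 : wprod [::] = 1 by rewrite /wprod big_nil.
have w2' : wprod [:: (false, a2)] = a2 by rewrite /wprod big_cons big_nil mulr1.
have DS n : D n = E ((1 + a2) * (a1 * a2) ^+ n * (1 + a1)) + D n.+1.
  by rewrite /D {1}zE exprSr -linearD; congr (E _); nc_ring.
have E4 p q r s : E (p + q + (r + s)) = E p + E q + (E r + E s).
  by rewrite !linearD.
(* Of the four words 1, a2, a1 and a2 a1, only the empty one has nonzero expectation. *)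
have D0 : D 0%N = 1 + D 1%N.
  rewrite DS expr0 mulr1.
  have -> : (1 + a2) * (1 + a1) = 1 + a2 + (a1 + a2 * a1) by nc_ring.
  have [v1 _] := vanish _ 0%N t2.1 t2.2; move: v1.
  rewrite w2' expr0 mulr1 => v1.
  by rewrite E4 v1 condexp_a1 condexp_a2 (condexp_unit hE) !addr0.
have Dn n : D n.+1 = D n.+2.
  rewrite DS.
  have -> : (1 + a2) * (a1 * a2) ^+ n.+1 * (1 + a1) =
    1 * (a1 * a2) ^+ n.+1 + 1 * (a1 * a2) ^+ n.+1 * a1 +
    (a2 * (a1 * a2) ^+ n.+1 + a2 * (a1 * a2) ^+ n.+1 * a1) by nc_ring.
  have [_ v1] := vanish _ n t0.1 t0.2; have [v2 _] := vanish _ n.+1 t0.1 t0.2.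
  have [_ v3] := vanish _ n t2.1 t2.2; have [v4 _] := vanish _ n.+1 t2.1 t2.2.
  by move: v1 v2 v3 v4; rewrite w0 w2' E4 => -> -> -> ->; rewrite !add0r.
have D1 : D 1%N = 0.
  have [C0 hC0] := alt_word_vanish (z * (1 + a1)) t0.1 t0.2.
  have [C2 hC2] := alt_word_vanish (z * (1 + a1)) t2.1 t2.2.
  have D1n n : D 1%N = D n.+1 by elim: n => // n ->; exact: Dn.
  (* [alt_word_vanish] controls squares of norms, hence the product; 1 + a2 splits into the two
     prefixes. *)
  have h : star (D 1%N) * D 1%N = 0.
    apply: (nrm_small (C := 2 * (C0 + C2)) q0 q1) => n.
    rewrite nrm_cstar (D1n n) /D.
    have := hC0 n.+1; have := hC2 n.+1; rewrite !wprod_alt w0 w2' mul1r.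
    set p0 := E ((a1 * a2) ^+ n.+1 * _); set p2 := E (a2 * _ * _).
    have -> : E ((1 + a2) * (a1 * a2) ^+ n.+1 * z * (1 + a1)) = p0 + p2.
      by rewrite /p0 /p2 -linearD; congr (E _); nc_ring.
    move=> g2 g0.
    have gd := nrmD p0 p2; have n0 := nrm_ge0 p0; have n2 := nrm_ge0 p2.
    have nD : nrm (p0 + p2) ^+ 2 <= (nrm p0 + nrm p2) ^+ 2.
      by rewrite lerXn2r ?nnegrE ?addr_ge0 ?nrm_ge0.
    have sq := sqr_ge0 (nrm p0 - nrm p2).
    have k : (C0 + C2) * conv_rate ^+ n.+1 <= (C0 + C2) * conv_rate ^+ n.
      have CC : 0 <= C0 + C2.
        have := le_trans (sqr_ge0 _) (hC0 0%N).
        have := le_trans (sqr_ge0 _) (hC2 0%N).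
        by rewrite !expr0 !mulr1 => c0 c2; rewrite addr_ge0.
      by rewrite ler_wpM2l // exprS ler_piMl ?exprn_ge0 // ltW.
    by move: nD sq; rewrite !expr2; move: g0 g2; rewrite !expr2; lra.
  apply: nrm_eq0; apply/eqP; rewrite -sqrf_eq0 -nrm_cstar h.
  by rewrite nrm0.
have FW1 : F * E W^-1 = 1.
  have := D0; rewrite D1 addr0 /D expr0 mulr1 -FW.
  by [].
by rewrite /Gtr -/W -[LHS]mul1r -GF -mulrA FW1 mulr1.
Qed.

End Convolution.

End FreePair.
End Freeness.

(** * Assembly of the subordination functions *)

Theorem theorem2p2 (R : realType) (M B : cstar_alg R)
    (incl : {lrmorphism B -> M}) (E : {linear M -> B})
    (hE : opv_prob_space incl E)
    (x y : M) (hx : selfadjoint x) (hy : selfadjoint y)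
    (hfree : free_over incl E x y) :
  exists w1 w2 : B -> B,
    [/\ subordination_pair incl E x y w1 w2,
        (forall v1 v2 : B -> B, subordination_pair incl E x y v1 v2 ->
           forall b, upper_half_plane b -> v1 b = w1 b /\ v2 b = w2 b),
        (forall b, upper_half_plane b ->
           attracting_unique_fixpoint (fixmap incl E x y b) (w1 b))
      & (forall b, upper_half_plane b ->
           attracting_unique_fixpoint (fixmap incl E y x b) (w2 b))].
Proof.
have fixpoint (u v : M) : star u = u -> star v = v -> exists w : B -> B,
    forall b, upper_half_plane b ->
      attracting_unique_fixpoint (fixmap incl E u v b) (w b).
  move=> hu hv; have ex b : exists c, upper_half_plane b ->
      attracting_unique_fixpoint (fixmap incl E u v b) c.
    (* [choice] asks for a value at every b; 0 is a default outside the half-plane. *)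
    have [hb|hb] := pselect (upper_half_plane b); last by exists 0.
    by have [c hc] := fixmap_attracting hE hu hv hb; exists c.
  by have [w hw] := choice ex; exists w.
have [w1 hw1] := fixpoint x y hx hy.
have [w2 hw2] := fixpoint y x hy hx.
have u1 b : upper_half_plane b ->
    upper_half_plane (w1 b) /\ fixmap incl E x y b (w1 b) = w1 b.
  by move=> /hw1[].
have u2 b : upper_half_plane b ->
    upper_half_plane (w2 b) /\ fixmap incl E y x b (w2 b) = w2 b.
  by move=> /hw2[].
have step_uhp (u : M) b w : star u = u -> upper_half_plane b ->
    upper_half_plane w -> upper_half_plane (htr incl E u w + b).
  move=> hu /upper_half_planeP[e e0 hb] /upper_half_planeP[d d0 hw].
  apply/upper_half_planeP; exists e => //.
  by apply: leA_trans hb _; apply: (step_region hE b hu d0 hw).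
(* w1 and w2 were chosen independently; h_x(w1) + b is a fixed point of the other map, hence equals
   w2 by uniqueness. *)
have w2E b : upper_half_plane b -> w2 b = htr incl E x (w1 b) + b.
  move=> hb; have [h1 f1] := u1 b hb; have [_ _ uniq _] := hw2 b hb.
  symmetry; apply: uniq; first exact: step_uhp.
  by rewrite /fixmap -/(fixmap incl E x y b (w1 b)) f1.
have w1E b : upper_half_plane b -> w1 b = htr incl E y (w2 b) + b.
  by move=> hb; have [_ f1] := u1 b hb; rewrite w2E // -{1}f1.
have F1 b : upper_half_plane b -> Ftr incl E x (w1 b) + b = w1 b + w2 b.
  by move=> hb; rewrite w2E // /htr; nc_ring.
have F2 b : upper_half_plane b -> Ftr incl E y (w2 b) + b = w1 b + w2 b.
  by move=> hb; rewrite w1E // /htr; nc_ring.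
have FE b : upper_half_plane b -> Ftr incl E x (w1 b) = Ftr incl E y (w2 b).
  by move=> hb; apply: (addIr b); rewrite F1 // F2.
exists w1, w2; split=> //.
- split.
  + by split=> b hb; [have [] := u1 b hb
                     | exact: (fixpoint_differentiable hE hx hy u1 hb)].
  + by split=> b hb; [have [] := u2 b hb
                     | exact: (fixpoint_differentiable hE hy hx u2 hb)].
  + move=> b hb.
    have e1 : w1 b - b = htr incl E y (w2 b) by rewrite {1}w1E // addrK.
    have e2 : w2 b - b = htr incl E x (w1 b) by rewrite {1}w2E // addrK.
    rewrite -!cImB e1 e2.
    have [/upper_half_planeP[d1 d10 h1] _] := u1 b hb.
    have [/upper_half_planeP[d2 d20 h2] _] := u2 b hb.
    by split; [exact: (cIm_htr_nonneg hE hy d20 h2)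
              | exact: (cIm_htr_nonneg hE hx d10 h1)].
  + by move=> b hb; rewrite F1 // F2.
  + move=> b hb; have GE : Gtr incl E x (w1 b) = Gtr incl E y (w2 b).
      (* Inversion is injective on the whole ring, non-units being left fixed, so F determines G. *)
      by apply: invr_inj; exact: FE.
    split=> //; rewrite -GE.
    have /upper_half_planeP[e e0 he] := hb.
    have ge1 : e *:c 1 <=p cIm (w1 b).
      have [/upper_half_planeP[d2 d20 h2] _] := u2 b hb.
      by apply: leA_trans he _; rewrite w1E //; apply: (step_region hE b hy d20 h2).
    have ge2 : e *:c 1 <=p cIm (w2 b).
      by apply: leA_trans he _; rewrite w2E //; apply: (step_region hE b hx e0 ge1).
    symmetry.
    exact: (free_convolution hE hx hy hfree e0 he ge1 ge2 (FE b hb) (F1 b hb)).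
(* Condition (2) reads v2 = h_x(v1) + b and v1 = h_y(v2) + b, so v1 and v2 are fixed points of the
   two maps. *)
- move=> v1 v2 [[v1H _] [v2H _] _ vF _] b hb; have [vF1 vF2] := vF b hb.
  have v2E : htr incl E x (v1 b) + b = v2 b.
    by rewrite /htr addrAC vF1 vF2 addrC addKr.
  have v1E : htr incl E y (v2 b) + b = v1 b by rewrite /htr addrAC vF2 addrK.
  have [_ _ uniq1 _] := hw1 b hb; have [_ _ uniq2 _] := hw2 b hb.
  split; [apply: uniq1|apply: uniq2]; rewrite ?/fixmap ?v2E ?v1E ?v2E //.
  + exact: v1H.
  + exact: v2H.
Qed.
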